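(* Let $f(t)=\sum_{k=0}^n a_kt^k$ with $n\ge1$ and $a_n\ne0$, and put $c_m=\sum_{k=m+1}^n k\binom{k-1}{m}a_k$ for $0\le m\le n-1$. (Complex case.) Suppose $a_k\in\mathbb{C}$ and $(-1)^n\mathrm{Re}(a_n)<0$. Let $\phi_f(x)=\exp(f(x))$ for $x\le0$ and $\Phi_f(s)=\int_{-\infty}^0(1-x)^s\phi_f(x)\,dx$ for $s\in\mathbb{C}$ (with $(1-x)^s=\exp(s\log(1-x))$, real log). Then the integral converges for every $s\in\mathbb{C}$, $\phi_f'(x)=\sum_{m=0}^{n-1}(-1)^mc_m(1-x)^m\phi_f(x)$, and for all $s\in\mathbb{C}$ $$\exp(a_0)+s\Phi_f(s-1)=\sum_{m=0}^{n-1}(-1)^mc_m\,\Phi_f(s+m).$$ ($p$-adic case.) Suppose $a_k\in\mathcal{O}_{\mathbb{C}_p}$, $a_0\in E_p$ and $a_1\in U_1$. Let $\phi_f\in C(\mathbb{Z}_p,\mathbb{C}_p)$ be the unique function with $A(\phi_f)=\exp(a_0)\exp(f(t)-a_0)$, and let $\Phi_f=T(\phi_f)$, i.e. $\Phi_f(s)=S^s(\phi_f)(-1)$ for $s\in\mathbb{Z}_p$. Then $\sigma(\phi_f)=\sum_{m=0}^{n-1}(-1)^mc_m\,S^m(\phi_f)$, and for all $s\in\mathbb{Z}_p$ $$\exp(a_0)+s\Phi_f(s-1)=\sum_{m=0}^{n-1}(-1)^mc_m\,\Phi_f(s+m).$$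
   Context: Fix a prime $p$; $\mathbb{C}_p$ is the completion of an algebraic closure of $\mathbb{Q}_p$ with $|p|=1/p$; $\mathcal{O}_{\mathbb{C}_p}=\{|x|\le1\}$, $U_1=\{|x-1|<1\}$, $E_p=\{|x|<p^{-1/(p-1)}\}$ (where the exponential series converges). $C(\mathbb{Z}_p,\mathbb{C}_p)$ is the space of continuous functions $\mathbb{Z}_p\to\mathbb{C}_p$; $\sigma(\phi)(x)=\phi(x+1)$; $A(\phi)=\sum_{n\ge0}\phi(n)t^n/n!$ (injective); the existence and uniqueness of $\phi_f$ holds for any $f\in\mathcal{O}_{\mathbb{C}_p}[[t]]$ with $f(0)\in E_p$, $f'(0)\in U_1$. For $n\ge0$, $\binom xn=x(x-1)\cdots(x-n+1)/n!$, and for $y\in\mathbb{Z}_p$, $S^y(\phi)(x)=\sum_{k\ge0}(-1)^kk!\binom yk\binom xk\phi(x-k)$. In both cases $\exp$ denotes the exponential series. *)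

(* Defs.v *)
From Stdlib Require Import Reals ClassicalEpsilon.
From Coquelicot Require Import Coquelicot.
From HB Require Import structures.
From mathcomp Require Import all_boot all_order all_algebra.

Set Implicit Arguments.
Unset Strict Implicit.
Unset Printing Implicit Defensive.

Definition cexp (z : C) : C :=
  epsilon (inhabits (RtoC 0))
    (fun l : C => is_series (fun k : nat => Cdiv (pow_n z k) (RtoC (INR (factorial k)))) l).

Definition fC (n : nat) (a : nat -> C) (x : R) : C :=
  sum_n (fun k => Cmult (a k) (pow_n (RtoC x) k)) n.

Definition phiC (n : nat) (a : nat -> C) (x : R) : C := cexp (fC n a x).

Definition cpowR (y : R) (s : C) : C := cexp (Cmult s (RtoC (ln y))).

Definition PhiC_integrand (n : nat) (a : nat -> C) (s : C) (x : R) : C :=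
  Cmult (cpowR (Rminus 1 x) s) (phiC n a x).

Definition PhiC (n : nat) (a : nat -> C) (s : C) : C :=
  @RInt_gen C_R_CompleteNormedModule (PhiC_integrand n a s) (Rbar_locally m_infty) (at_point 0).

Definition cC (n : nat) (a : nat -> C) (m : nat) : C :=
  sum_n_m (fun k => Cmult (RtoC (INR (k * binomial k.-1 m))) (a k)) m.+1 n.

Import GRing.Theory.
Local Open Scope ring_scope.

Section Padic.
Variables (K : closedFieldType) (absv : K -> R).

Definition in_Qp (x : K) : Prop :=
  forall eps : R, Rlt R0 eps -> exists r : rat, Rlt (absv (x - ratr r)) eps.

Definition in_Zp (x : K) : Prop :=
  forall eps : R, Rlt R0 eps -> exists z : int, Rlt (absv (x - z%:~R)) eps.

Definition in_O (x : K) : Prop := Rle (absv x) R1.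
Definition in_U1 (x : K) : Prop := Rlt (absv (x - 1)) R1.

Definition cauchy_seq (u : nat -> K) : Prop :=
  forall eps : R, Rlt R0 eps -> exists N : nat,
    forall i j : nat, (N <= i)%N -> (N <= j)%N -> Rlt (absv (u i - u j)) eps.

Definition cvg_seq (u : nat -> K) (l : K) : Prop :=
  forall eps : R, Rlt R0 eps -> exists N : nat,
    forall i : nat, (N <= i)%N -> Rlt (absv (u i - l)) eps.

(* (K, absv) is a model of C_p: an algebraically closed field with a
   non-archimedean absolute value, |p| = 1/p, complete, in which the
   elements algebraic over the closure of Q (= Q_p) are dense.  These
   properties characterize C_p up to isometric isomorphism. *)
Definition is_Cp (p : nat) : Prop :=
  [/\ prime p,
      (forall x, Rle R0 (absv x) /\ (absv x = R0 <-> x = 0)),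
      (forall x y, absv (x * y) = Rmult (absv x) (absv y)),
      (forall x y, Rle (absv (x + y)) (Rmax (absv x) (absv y))) &
      absv (p%:R) = Rinv (INR p)] /\
  ((forall u, cauchy_seq u -> exists l, cvg_seq u l) /\
      (forall x eps, Rlt R0 eps -> exists y : K,
          Rlt (absv (x - y)) eps /\
          exists q : {poly K}, [/\ q != 0, root q y & forall i, in_Qp q`_i])).

Definition in_Ep (p : nat) (x : K) : Prop :=
  Rlt (absv x) (Rpower (INR p) (Ropp (Rinv (Rminus (INR p) R1)))).

Definition series_cvg (u : nat -> K) (l : K) : Prop :=
  cvg_seq (fun m => \sum_(k < m) u k) l.
Definition ssum (u : nat -> K) : K := epsilon (inhabits 0) (series_cvg u).

Definition expK (x : K) : K := ssum (fun k => x ^+ k / (k`!)%:R).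

Definition binomK (x : K) (n : nat) : K :=
  (\prod_(i < n) (x - i%:R)) / (n`!)%:R.

Definition cont_Zp (phi : K -> K) : Prop :=
  forall x, in_Zp x -> forall eps : R, Rlt R0 eps -> exists delta : R,
    Rlt R0 delta /\ forall y, in_Zp y -> Rlt (absv (x - y)) delta ->
      Rlt (absv (phi x - phi y)) eps.

(* A(phi) = exp(a_0) exp(f(t) - a_0) as formal power series:
   the coefficient of t^N on the left is phi(N)/N!, on the right it is
   exp(a_0) * sum_{k<=N} [t^N] (f - a_0)^k / k!  (only k <= N contribute,
   since f - a_0 has no constant term). *)
Definition A_eq (phi : K -> K) (f : {poly K}) : Prop :=
  forall N : nat,
    phi N%:R / (N`!)%:R =
    expK (f`_0) * \sum_(k < N.+1) (((f - (f`_0)%:P) ^+ k)`_N / (k`!)%:R).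

Definition Sop (y : K) (phi : K -> K) (x : K) : K :=
  ssum (fun k => (-1) ^+ k * (k`!)%:R * binomK y k * binomK x k * phi (x - k%:R)).

Definition Top (phi : K -> K) (s : K) : K := Sop s phi (-1).

End Padic.

Definition cK (K : fieldType) (n : nat) (a : nat -> K) (m : nat) : K :=
  \sum_(m.+1 <= k < n.+1) (k * 'C(k.-1, m))%:R * a k.

(* Main.v *)
(* Both recurrences come from differentiating phi_f = exp o f.

   Complex case: as f'(x) = sum_m (-1)^m c_m (1-x)^m, the function
   G(x) = (1-x)^s phi_f(x) satisfies
   G'(x) = - s (1-x)^(s-1) phi_f(x) + sum_m (-1)^m c_m (1-x)^(s+m) phi_f(x).
   The sign condition on Re a_n makes G bounded on x <= 0 for every s; replacing
   s by s+1 and s+2 bounds |G(x)| by M/(1-x) and M/(1-x)^2, so that the integrals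
   converge and G vanishes at -oo.  The recurrence is the integral of G'.

   p-adic case: A(phi_f)' = f' A(phi_f) reads, at natural x,
   phi_f(x+1) = sum_j (j+1) a_(j+1) x(x-1)...(x-j+1) phi_f(x-j),
   and extends to Z_p by continuity; it also gives |phi_f| <= |phi_f(0)| on Z_p,
   whence all series converge.  By Pascal's rule the j-th iterated difference of
   s |-> S^s(phi)(x) is again an explicit series, so that
   sum_m (-1)^m c_m S^(s+m)(phi)(x) can be compared term by term with the functional
   equation: s = 0 gives the formula for sigma(phi_f), and x = -1 the recurrence. *)

Require Import Defs.
From Stdlib Require Import Reals Lra Lia.
From Coquelicot Require Import Coquelicot.
From HB Require Import structures.
From mathcomp Require Import all_boot all_order all_algebra.
Import GRing.Theory.
Local Open Scope ring_scope.

(** * The complex case *)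

Ltac Rring := lazymatch goal with |- @eq _ ?a ?b => change (@eq R a b) end; ring.
Ltac Cring := lazymatch goal with |- @eq _ ?a ?b => change (@eq C a b) end; ring.

(** * The complex exponential series and its polar form *)

Section ComplexExponential.
Local Open Scope R_scope.

Lemma Re_mul_RtoC (z : C) (r : R) : Re (Cmult z (RtoC r)) = Re z * r.
Proof. by rewrite /Re /=; ring. Qed.

Lemma Im_mul_RtoC (z : C) (r : R) : Im (Cmult z (RtoC r)) = Im z * r.
Proof. by rewrite /Im /=; ring. Qed.

Lemma Re_sum_n (u : nat -> C) (n : nat) : Re (sum_n u n) = sum_n (fun k => Re (u k)) n.
Proof. by elim: n => [|n IH]; rewrite ?sum_O // !sum_Sn -IH. Qed.

Lemma Im_sum_n (u : nat -> C) (n : nat) : Im (sum_n u n) = sum_n (fun k => Im (u k)) n.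
Proof. by elim: n => [|n IH]; rewrite ?sum_O // !sum_Sn -IH. Qed.

Lemma is_series_C (u : nat -> C) (x y : R) :
  is_series (fun k => Re (u k)) x -> is_series (fun k => Im (u k)) y ->
  is_series u ((x, y) : C).
Proof.
move=> ux uy P [eps HP].
have [N1 H1] := ux _ (locally_ball x eps).
have [N2 H2] := uy _ (locally_ball y eps).
exists (N1 + N2)%coq_nat => m Hm; apply: HP; split.
- by rewrite [X in ball _ _ X](Re_sum_n u m); apply: H1; lia.
- by rewrite [X in ball _ _ X](Im_sum_n u m); apply: H2; lia.
Qed.

Lemma sum_n_Cmult_l (c : C) (u : nat -> C) (n : nat) :
  sum_n (fun k => Cmult c (u k)) n = Cmult c (sum_n u n).
Proof. exact: (sum_n_mult_l (K := C_Ring)). Qed.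

Lemma sum_n_Cplus (u v : nat -> C) (n : nat) :
  sum_n (fun k => Cplus (u k) (v k)) n = Cplus (sum_n u n) (sum_n v n).
Proof. exact: (sum_n_plus (G := C_AbelianMonoid)). Qed.

(** The summand of the series in [cexp], kept convertible to it so that the specification of
    [epsilon] applies directly. *)
Definition expC_term (z : C) (k : nat) : C := Cdiv (pow_n z k) (RtoC (INR k`!)).

Lemma INR_fact_neq0 (k : nat) : INR k`! <> 0.
Proof. by apply: not_0_INR; have := fact_gt0 k; case: (k`!). Qed.

Lemma expC_termS (z : C) (k : nat) :
  Cmult (RtoC (INR k.+1)) (expC_term z k.+1) = Cmult z (expC_term z k).
Proof.
rewrite /expC_term factS -multE mult_INR RtoC_mult -[pow_n z k.+1]/(Cmult z (pow_n z k)).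
have h1 : RtoC (INR k`!) <> RtoC 0 by move=> /RtoC_inj /INR_fact_neq0.
have h2 : RtoC (INR k.+1) <> RtoC 0 by move=> /RtoC_inj; apply: not_0_INR.
by field.
Qed.

(** The binomial theorem divided by [k!], proved without binomial coefficients: both sides satisfy
    the recursion [(k+1) t_(k+1) = (z + w) t_k]. *)
Lemma expC_termD (z w : C) (k : nat) :
  expC_term (Cplus z w) k = sum_n (fun j => Cmult (expC_term z j) (expC_term w (k - j))) k.
Proof.
elim: k => [|k IH].
  rewrite sum_O; change (Cdiv (RtoC 1) (RtoC 1) =
    Cmult (Cdiv (RtoC 1) (RtoC 1)) (Cdiv (RtoC 1) (RtoC 1))).
  by field; move=> /RtoC_inj; lra.
have h2 : RtoC (INR k.+1) <> RtoC 0 by move=> /RtoC_inj; apply: not_0_INR.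
suff E : Cmult (RtoC (INR k.+1)) (expC_term (Cplus z w) k.+1) =
  Cmult (RtoC (INR k.+1)) (sum_n (fun j => Cmult (expC_term z j) (expC_term w (k.+1 - j))) k.+1).
  have := f_equal (Cmult (Cinv (RtoC (INR k.+1)))) E.
  by rewrite !Cmult_assoc Cinv_l // !Cmult_1_l.
rewrite expC_termS IH.
(* Leibniz rule: the weight [k+1] splits as [j + (k+1-j)], and [expC_termS] lowers the first factor
   in one half and the second factor in the other. *)
rewrite -[RHS]sum_n_Cmult_l [RHS](sum_n_ext_loc _ (fun j => Cplus
   (Cmult (Cmult (RtoC (INR j)) (expC_term z j)) (expC_term w (k.+1 - j)))
   (Cmult (expC_term z j) (Cmult (RtoC (INR (k.+1 - j))) (expC_term w (k.+1 - j)))))); last first.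
  move=> j Hj; have -> : INR (k.+1 - j) = INR k.+1 - INR j by exact: minus_INR.
  rewrite RtoC_minus; Cring.
rewrite sum_n_Cplus.
have -> : sum_n (fun j => Cmult (Cmult (RtoC (INR j)) (expC_term z j))
    (expC_term w (k.+1 - j))) k.+1
  = Cmult z (sum_n (fun j => Cmult (expC_term z j) (expC_term w (k - j))) k).
  rewrite -sum_n_Cmult_l /sum_n sum_Sn_m; last lia.
  rewrite Cmult_0_l Cmult_0_l plus_zero_l -sum_n_m_S.
  apply: sum_n_m_ext => j; rewrite expC_termS subSS; Cring.
have -> : sum_n (fun j => Cmult (expC_term z j)
     (Cmult (RtoC (INR (k.+1 - j))) (expC_term w (k.+1 - j)))) k.+1
  = Cmult w (sum_n (fun j => Cmult (expC_term z j) (expC_term w (k - j))) k).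
  rewrite sum_Sn subnn Cmult_0_l Cmult_0_r plus_zero_r -sum_n_Cmult_l.
  apply: sum_n_ext_loc => j Hj.
  rewrite subSn; last by apply/leP.
  by rewrite expC_termS; Cring.
Cring.
Qed.

Lemma pow_n_Ci_even (k : nat) : pow_n Ci (2 * k)%coq_nat = RtoC ((-1) ^ k).
Proof.
elim: k => [|k IH]; first by [].
have -> : (2 * k.+1)%coq_nat = (2 * k)%coq_nat.+2 by lia.
move: IH => /= ->.
by rewrite /mult /= /Cmult /RtoC /=; congr pair; ring.
Qed.

Lemma fact_Stdlib (k : nat) : k`! = Factorial.fact k.
Proof. by elim: k => // k IH; rewrite factS IH. Qed.

Lemma expC_term_i (y : R) (k : nat) :
  expC_term (0, y) k = Cmult (pow_n Ci k) (RtoC (y ^ k / INR k`!)).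
Proof.
rewrite /expC_term RtoC_div /Cdiv ?Cmult_assoc; last exact: INR_fact_neq0.
congr Cmult; elim: k => [|k IH] /=; first by rewrite /one /= Cmult_1_l.
rewrite IH /mult /= RtoC_mult.
have -> : ((0, y) : C) = Cmult Ci (RtoC y) by rewrite /Cmult /RtoC /=; congr pair; ring.
Cring.
Qed.

Lemma expC_term_R (x : R) (k : nat) : expC_term (RtoC x) k = RtoC (x ^ k / INR k`!).
Proof.
rewrite /expC_term RtoC_div; last exact: INR_fact_neq0.
congr Cdiv; elim: k => [|k IH] //=.
by rewrite IH RtoC_mult.
Qed.

Lemma is_series_exp (x : R) : is_series (fun k => x ^ k / INR k`!) (exp x).
Proof.
apply: is_series_ext (is_exp_Reals x) => k.
by rewrite pow_n_pow fact_Stdlib.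
Qed.

Lemma is_series_zero : is_series (fun _ : nat => 0) 0.
Proof.
apply: (filterlim_ext (fun _ => 0)) (filterlim_const 0) => n.
by rewrite sum_n_const Rmult_0_r.
Qed.

(** [Re (i^k)] is [(-1)^m] at [k = 2m] and zero at odd [k], so the even part of this power series is
    the one in [y^2] that defines [cos]. *)
Lemma is_series_cos (y : R) : is_series (fun k => Re (expC_term (0, y) k)) (cos y).
Proof.
have H : is_pseries (fun k => Re (pow_n Ci k) / INR k`!) y (cos y + y * 0).
  apply: is_pseries_odd_even.
  - move: (proj2_sig (exist_cos (Rsqr y))); rewrite -/(cos y) => H.
    apply: is_series_ext (proj2 (is_series_Reals _ _) H) => k.
    rewrite pow_n_Ci_even fact_Stdlib /cos_n pow_n_pow Rsqr_pow2 /=.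
    by rewrite [RHS]Rmult_comm.
  - apply: is_series_ext is_series_zero => k.
    have -> : ((2 * k)%coq_nat + 1)%coq_nat = (2 * k)%coq_nat.+1 by lia.
    by rewrite [pow_n Ci _]/= pow_n_Ci_even /mult /= /scal /= /mult /= /Rdiv; Rring.
rewrite Rmult_0_r Rplus_0_r in H.
apply: is_series_ext H => k.
rewrite expC_term_i Re_mul_RtoC pow_n_pow /scal /= /mult /= /Rdiv; Rring.
Qed.

(** Here the even part vanishes, and the factor [y] in front of the odd part is the one in the
    definition of [sin]. *)
Lemma is_series_sin (y : R) : is_series (fun k => Im (expC_term (0, y) k)) (sin y).
Proof.
have H : is_pseries (fun k => Im (pow_n Ci k) / INR k`!) y (0 + sin y).
  rewrite /sin; case: (exist_sin (Rsqr y)) => l Hl.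
  apply: is_pseries_odd_even.
  - apply: is_series_ext is_series_zero => k.
    by rewrite pow_n_Ci_even /scal /= /mult /= /Rdiv; Rring.
  - apply: is_series_ext (proj2 (is_series_Reals _ _) Hl) => k.
    rewrite /sin_n fact_Stdlib pow_n_pow Rsqr_pow2.
    have -> : ((2 * k)%coq_nat + 1)%coq_nat = (2 * k)%coq_nat.+1 by lia.
    by rewrite [pow_n Ci _]/= pow_n_Ci_even /mult /= /scal /= /mult /= /Rdiv; Rring.
rewrite Rplus_0_l in H.
apply: is_series_ext H => k.
by rewrite expC_term_i Im_mul_RtoC pow_n_pow /scal /= /mult /= /Rdiv; Rring.
Qed.

(** Since [|i| = 1], the modulus of the term is the right-hand side. This gives the absolute
    convergence that the Cauchy product needs. *)
Lemma expC_term_i_bound (y : R) (k : nat) :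
  Rabs (Re (expC_term (0, y) k)) <= Rabs y ^ k / INR k`! /\
  Rabs (Im (expC_term (0, y) k)) <= Rabs y ^ k / INR k`!.
Proof.
have H0 : 0 < INR k`! by apply: lt_0_INR; apply/ltP; exact: fact_gt0.
have -> : Rabs y ^ k / INR k`! = Cmod (expC_term (0, y) k).
  rewrite expC_term_i Cmod_mult Cmod_R /Rdiv Rabs_mult Rabs_inv -RPow_abs
    (Rabs_pos_eq (INR _)); last lra.
  have -> : Cmod (pow_n Ci k) = 1; last ring.
  elim: k {H0} => [|k IH] /=; first exact: Cmod_1.
  by rewrite Cmod_mult IH /Cmod /= !Rmult_0_l !Rmult_1_r Rplus_0_l sqrt_1.
have H := Rmax_Cmod (expC_term (0, y) k).
by split; apply: Rle_trans H; [exact: Rmax_l | exact: Rmax_r].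
Qed.

Lemma ex_series_Rabs_expC_term_i (y : R) :
  ex_series (fun k => Rabs (Re (expC_term (0, y) k))) /\
  ex_series (fun k => Rabs (Im (expC_term (0, y) k))).
Proof.
have E : ex_series (fun k => Rabs y ^ k / INR k`!) by eexists; apply: is_series_exp.
split; apply: (ex_series_le (K := R_AbsRing) (V := R_CompleteNormedModule)) E => k;
  rewrite /norm /= /abs /= Rabs_Rabsolu; by case: (expC_term_i_bound y k).
Qed.

Lemma ex_series_Rabs_exp (x : R) : ex_series (fun k => Rabs (x ^ k / INR k`!)).
Proof.
exists (exp (Rabs x)); apply: is_series_ext (is_series_exp (Rabs x)) => k.
rewrite /Rdiv Rabs_mult Rabs_inv RPow_abs (Rabs_pos_eq (INR _)) //; exact: pos_INR.
Qed.

(** Cauchy product of the series at [iy] and at [x]. The second has real terms, so real and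
    imaginary parts of the product are real Cauchy products. *)
Lemma is_series_expC (x y : R) :
  is_series (expC_term (x, y)) ((exp x * cos y, exp x * sin y) : C).
Proof.
have E k : expC_term (x, y) k =
    sum_n (fun j => Cmult (expC_term (0, y) j) (RtoC (x ^ (k - j) / INR (k - j)`!))) k.
  have -> : ((x, y) : C) = Cplus (0, y) (RtoC x).
    by rewrite /Cplus /RtoC /=; congr pair; ring.
  by rewrite expC_termD; apply: sum_n_ext => j; rewrite expC_term_R.
have [ec es] := ex_series_Rabs_expC_term_i y.
apply: is_series_C; rewrite Rmult_comm.
- apply: is_series_ext (is_series_mult _ _ _ _ (is_series_cos y) (is_series_exp x) ec
    (ex_series_Rabs_exp x)) => k.
  by rewrite E Re_sum_n -sum_n_Reals; apply: sum_n_ext => j; rewrite Re_mul_RtoC.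
- apply: is_series_ext (is_series_mult _ _ _ _ (is_series_sin y) (is_series_exp x) es
    (ex_series_Rabs_exp x)) => k.
  by rewrite E Im_sum_n -sum_n_Reals; apply: sum_n_ext => j; rewrite Im_mul_RtoC.
Qed.

(** [epsilon] returns some limit of the series as soon as one exists; by uniqueness of limits it is
    the one computed above. *)
Lemma cexpE (z : C) : cexp z = (exp (Re z) * cos (Im z), exp (Re z) * sin (Im z)).
Proof.
have H : is_series (expC_term z) ((exp (Re z) * cos (Im z), exp (Re z) * sin (Im z)) : C).
  by case: z => x y; exact: is_series_expC.
have H' : is_series (expC_term z) (cexp z).
  exact: (ClassicalEpsilon.epsilon_spec (inhabits (RtoC 0)) _ (ex_intro _ _ H)).
exact: (filterlim_locally_unique _ _ _ H' H).
Qed.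

Lemma cexpD (z w : C) : cexp (Cplus z w) = Cmult (cexp z) (cexp w).
Proof.
by rewrite !cexpE /Cmult /Re /Im /= exp_plus cos_plus sin_plus; congr pair; ring.
Qed.

Lemma cexp_RtoC (x : R) : cexp (RtoC x) = RtoC (exp x).
Proof. by rewrite cexpE /= cos_0 sin_0 /RtoC; congr pair; ring. Qed.

Lemma Cmod_cexp (z : C) : Cmod (cexp z) = exp (Re z).
Proof.
rewrite cexpE /Cmod /=.
have -> : forall e c s, e * c * (e * c * 1) + e * s * (e * s * 1) = Rsqr e * (Rsqr s + Rsqr c).
  by move=> e c s; rewrite /Rsqr; ring.
rewrite sin2_cos2 Rmult_1_r sqrt_Rsqr //; apply: Rlt_le; exact: exp_pos.
Qed.

(** * Differentiation of complex-valued functions of a real variable *)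

Lemma is_derive_C (f : R -> C) (x u v : R) :
  is_derive (fun t => Re (f t)) x u -> is_derive (fun t => Im (f t)) x v ->
  @is_derive R_AbsRing C_R_NormedModule f x ((u, v) : C).
Proof.
move=> fu fv.
have H := is_derive_plus _ _ _ _ _
  (is_derive_scal_l (V := C_R_NormedModule) _ _ _ ((1, 0) : C) fu)
  (is_derive_scal_l (V := C_R_NormedModule) _ _ _ ((0, 1) : C) fv).
move: H; have -> : plus (scal u ((1, 0) : C_R_NormedModule)) (scal v ((0, 1) : C_R_NormedModule))
  = ((u, v) : C_R_NormedModule).
  rewrite /plus /scal /= /prod_plus /prod_scal /= /scal /plus /= /mult /=; congr pair; Rring.
apply: is_derive_ext => t.
rewrite [RHS]surjective_pairing /Re /Im.
by rewrite /plus /scal /= /prod_plus /prod_scal /= /scal /plus /= /mult /=; congr pair; Rring.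
Qed.

Lemma is_derive_Re (f : R -> C) (x : R) (l : C) :
  @is_derive R_AbsRing C_R_NormedModule f x l -> is_derive (fun t => Re (f t)) x (Re l).
Proof.
move=> H.
have L : is_linear (fun z : C_R_NormedModule => Re z : R_NormedModule) by exact: is_linear_fst.
have H1 := filterdiff_comp _ _ _ _ H (filterdiff_linear _ L).
by apply: filterdiff_ext_lin (H1 _) _.
Qed.

Lemma is_derive_Im (f : R -> C) (x : R) (l : C) :
  @is_derive R_AbsRing C_R_NormedModule f x l -> is_derive (fun t => Im (f t)) x (Im l).
Proof.
move=> H.
have L : is_linear (fun z : C_R_NormedModule => Im z : R_NormedModule) by exact: is_linear_snd.
have H1 := filterdiff_comp _ _ _ _ H (filterdiff_linear _ L).
by apply: filterdiff_ext_lin (H1 _) _.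
Qed.

(** The polar form reduces the chain rule to the real functions [exp], [cos] and [sin]. *)
Lemma is_derive_cexp (f : R -> C) (x : R) (l : C) :
  @is_derive R_AbsRing C_R_NormedModule f x l ->
  @is_derive R_AbsRing C_R_NormedModule (fun t => cexp (f t)) x (Cmult l (cexp (f x))).
Proof.
move=> H; have hu := is_derive_Re _ _ _ H; have hv := is_derive_Im _ _ _ H.
apply: (is_derive_ext (K := R_AbsRing) (V := C_R_NormedModule)
  (fun t => (exp (Re (f t)) * cos (Im (f t)), exp (Re (f t)) * sin (Im (f t))) : C)).
  by move=> t; rewrite cexpE.
have he := is_derive_comp exp _ _ _ _ (is_derive_exp _) hu.
have hc := is_derive_comp cos _ _ _ _ (is_derive_cos _) hv.
have hs := is_derive_comp sin _ _ _ _ (is_derive_sin _) hv.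
rewrite cexpE [Cmult _ _]surjective_pairing.
apply: is_derive_C => /=.
- have := is_derive_mult _ _ _ _ _ he hc Rmult_comm.
  rewrite /plus /mult /scal /= /mult /=; set a := (X in is_derive _ _ X).
  by have -> : a = l.1 * (exp (Re (f x)) * cos (Im (f x))) - l.2 * (exp (Re (f x)) * sin (Im (f x)))
    by rewrite /a /Re /Im; ring.
- have := is_derive_mult _ _ _ _ _ he hs Rmult_comm.
  rewrite /plus /mult /scal /= /mult /=; set a := (X in is_derive _ _ X).
  by have -> : a = l.1 * (exp (Re (f x)) * sin (Im (f x))) + l.2 * (exp (Re (f x)) * cos (Im (f x)))
    by rewrite /a /Re /Im; ring.
Qed.

Lemma scal_C (r : R) (z : C) : scal r (z : C_R_NormedModule) = Cmult (RtoC r) z.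
Proof.
rewrite /scal /= /prod_scal /scal /= /mult /= /Cmult /RtoC /=; congr pair; ring.
Qed.

(** * Expansion of f' in powers of 1 - x *)

Lemma sum_n_shift (u : nat -> R) (n : nat) :
  sum_n u n.+1 = u 0%N + sum_n (fun k => u k.+1) n.
Proof. by rewrite /sum_n sum_Sn_m; [rewrite -sum_n_m_S | lia]. Qed.

Lemma sum_n_Rmult_l (c : R) (u : nat -> R) (n : nat) :
  sum_n (fun k => c * u k) n = c * sum_n u n.
Proof. exact: (sum_n_mult_l (K := R_Ring)). Qed.

Lemma sum_n_Rplus (u v : nat -> R) (n : nat) :
  sum_n (fun k => u k + v k) n = sum_n u n + sum_n v n.
Proof. exact: (sum_n_plus (G := R_AbelianMonoid)). Qed.

Lemma sum_n_RtoC (u : nat -> R) (n : nat) :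
  RtoC (sum_n u n) = sum_n (fun k => RtoC (u k)) n.
Proof.
elim: n => [|n IH]; first by rewrite !sum_O.
rewrite !sum_Sn -IH; exact: RtoC_plus.
Qed.

(** Binomial expansion of [(1 - (1 - x))^k]. The upper limit [n] does not depend on [k], so that
    sums over [k] and [m] can later be exchanged. *)
Lemma pow_expand_1minus (x : R) (k n : nat) : (k <= n)%N ->
  sum_n (fun m => (-1) ^ m * INR 'C(k, m) * (1 - x) ^ m) n = x ^ k.
Proof.
elim: k n => [|k IH] [|n] //.
- by move=> _; rewrite sum_O /=; ring.
- move=> _; rewrite sum_n_shift (sum_n_ext _ (fun _ => 0)).
    by rewrite sum_n_const /=; ring.
  by move=> m; rewrite bin0n /=; ring.
- move=> Hk.
  (* By Pascal's rule the induction hypothesis is needed twice: up to [n.+1] for the part with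
     ['C(k, m.+1)], and up to [n] for the part with ['C(k, m)]. *)
  have := IH n.+1 (leqW Hk); rewrite !sum_n_shift !bin0 => H.
  rewrite (sum_n_ext _ (fun m => (-1) ^ m.+1 * INR 'C(k, m.+1) * (1 - x) ^ m.+1 +
    (-(1 - x)) * ((-1) ^ m * INR 'C(k, m) * (1 - x) ^ m))); last first.
    by move=> m; rewrite binS -plusE plus_INR /=; ring.
  rewrite sum_n_Rplus sum_n_Rmult_l IH // -Rplus_assoc H /=; ring.
Qed.

(** The added terms [k <= m] vanish: for [k = 0] because of the factor [k], otherwise because
    [k - 1 < m]. *)
Lemma cC_full (n : nat) (a : nat -> C) (m : nat) : (m < n)%N ->
  cC n a m = sum_n (fun k => Cmult (RtoC (INR (k * 'C(k.-1, m)))) (a k)) n.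
Proof.
move=> mn; rewrite /cC /sum_n (sum_n_m_Chasles _ 0 m n); [|lia|exact/leP/ltnW].
rewrite (sum_n_m_ext_loc _ (fun _ => zero) 0 m) ?sum_n_m_const_zero ?plus_zero_l //.
move=> [|k] [_ /leP km]; first by rewrite mul0n Cmult_0_l.
by rewrite bin_small // muln0 Cmult_0_l.
Qed.

Definition dfC (n : nat) (a : nat -> C) (x : R) : C :=
  sum_n (fun k => Cmult (RtoC (INR k * x ^ k.-1)) (a k)) n.

(** Expanding each [x ^ k.-1] in powers of [1 - x] and exchanging the sums collects [(-1)^m c_m] in
    front of [(1 - x)^m]. *)
Lemma dfC_expand (n : nat) (a : nat -> C) (x : R) : (1 <= n)%N ->
  dfC n a x = sum_n (fun m => Cmult (Cmult (RtoC ((-1) ^ m)) (cC n a m)) (RtoC ((1 - x) ^ m))) n.-1.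
Proof.
move=> n1; rewrite /dfC.
rewrite (sum_n_ext_loc _ (fun k => sum_n (fun m => Cmult (Cmult (RtoC ((-1) ^ m))
   (Cmult (RtoC (INR (k * 'C(k.-1, m)))) (a k))) (RtoC ((1 - x) ^ m))) n.-1)).
  rewrite sum_n_switch; apply: sum_n_ext_loc => m /leP Hm.
  rewrite cC_full; last by rewrite -(prednK n1) ltnS.
  rewrite Cmult_comm -!sum_n_Cmult_l; apply: sum_n_ext => k; Cring.
move=> k /leP kn.
rewrite -(pow_expand_1minus x k.-1 n.-1); last by rewrite -!subn1 leq_sub2r.
rewrite -sum_n_Rmult_l sum_n_RtoC Cmult_comm -sum_n_Cmult_l.
apply: sum_n_ext => m; rewrite -multE mult_INR !RtoC_mult; Cring.
Qed.

(** * The derivatives of phi_f and of (1-x)^s phi_f(x) *)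

Lemma pow_n_RtoC (x : R) (k : nat) : pow_n (RtoC x) k = RtoC (x ^ k).
Proof. by elim: k => [|k IH] //=; rewrite IH RtoC_mult. Qed.

Lemma is_derive_fC (n : nat) (a : nat -> C) (x : R) :
  @is_derive R_AbsRing C_R_NormedModule (fC n a) x (dfC n a x).
Proof.
apply: (is_derive_sum_n (V := C_R_NormedModule)) => k _.
apply: (is_derive_ext (K := R_AbsRing) (V := C_R_NormedModule)
   (fun t => scal (t ^ k) (a k : C_R_NormedModule))).
  by move=> t; rewrite pow_n_RtoC scal_C Cmult_comm.
have -> : Cmult (RtoC (INR k * x ^ k.-1)) (a k) =
   scal (INR k * x ^ k.-1) (a k : C_R_NormedModule).
  by rewrite scal_C.
apply: is_derive_scal_l.
by auto_derive => //; rewrite Rmult_1_l.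
Qed.

Lemma is_derive_phiC (n : nat) (a : nat -> C) (x : R) :
  @is_derive R_AbsRing C_R_NormedModule (phiC n a) x (Cmult (dfC n a x) (phiC n a x)).
Proof. exact: is_derive_cexp (is_derive_fC n a x). Qed.

Lemma PhiC_integrandE (n : nat) (a : nat -> C) (s : C) (x : R) :
  PhiC_integrand n a s x = cexp (Cplus (Cmult s (RtoC (ln (1 - x)))) (fC n a x)).
Proof. by rewrite cexpD. Qed.

Lemma PhiC_integrand_shift (n : nat) (a : nat -> C) (s : C) (m : nat) (x : R) : x <= 0 ->
  PhiC_integrand n a (Cplus s (RtoC (INR m))) x =
  Cmult (RtoC ((1 - x) ^ m)) (PhiC_integrand n a s x).
Proof.
move=> x0; rewrite /PhiC_integrand /cpowR.
rewrite (_ : Cmult (Cplus _ _) _ =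
    Cplus (RtoC (INR m * ln (1 - x))) (Cmult s (RtoC (ln (1 - x))))); last first.
  rewrite RtoC_mult; ring.
rewrite cexpD cexp_RtoC -/(Rpower _ _) Rpower_pow; last lra.
ring.
Qed.

(** As a single exponential, the integrand has logarithmic derivative [-s/(1-x) + f'(x)]. The factor
    [1/(1-x)] lowers [s] by one, and each [(1-x)^m] in [f'] raises it by [m]. *)
Lemma is_derive_PhiC_integrand (n : nat) (a : nat -> C) (s : C) (x : R) : (1 <= n)%N -> x <= 0 ->
  @is_derive R_AbsRing C_R_NormedModule (PhiC_integrand n a s) x
    (Cplus (Cmult (Copp s) (PhiC_integrand n a (Cminus s (RtoC 1)) x))
      (sum_n (fun m => Cmult (Cmult (RtoC ((-1) ^ m)) (cC n a m))
                             (PhiC_integrand n a (Cplus s (RtoC (INR m))) x)) n.-1)).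
Proof.
move=> n1 x0.
apply: (is_derive_ext (K := R_AbsRing) (V := C_R_NormedModule)
  (fun x => cexp (Cplus (Cmult s (RtoC (ln (1 - x)))) (fC n a x)))).
  by move=> t; rewrite PhiC_integrandE.
have E1 : PhiC_integrand n a s x = Cmult (RtoC (1 - x)) (PhiC_integrand n a (Cminus s (RtoC 1)) x).
  have := PhiC_integrand_shift n a (Cminus s (RtoC 1)) 1 x x0.
  rewrite pow_1 => <-; congr PhiC_integrand; rewrite /=; ring.
have -> : sum_n (fun m => Cmult (Cmult (RtoC ((-1) ^ m)) (cC n a m))
     (PhiC_integrand n a (Cplus s (RtoC (INR m))) x)) n.-1
  = Cmult (dfC n a x) (PhiC_integrand n a s x).
  rewrite dfC_expand // Cmult_comm -sum_n_Cmult_l; apply: sum_n_ext => m.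
  rewrite PhiC_integrand_shift //; Cring.
have -> : Cmult (Copp s) (PhiC_integrand n a (Cminus s (RtoC 1)) x) =
   Cmult (Cmult s (RtoC (- / (1 - x)))) (PhiC_integrand n a s x).
  rewrite E1 RtoC_opp RtoC_inv; last lra.
  by field; move=> /RtoC_inj; lra.
rewrite -Cmult_plus_distr_r PhiC_integrandE.
apply: (is_derive_cexp (fun x => Cplus (Cmult s (RtoC (ln (1 - x)))) (fC n a x))).
apply: (is_derive_plus (V := C_R_NormedModule)); last exact: is_derive_fC.
have H : is_derive (fun t => ln (1 - t)) x (- / (1 - x)).
  by auto_derive; [lra | field; lra].
have := is_derive_scal_l (V := C_R_NormedModule) _ _ _ (s : C_R_NormedModule) H.
set l := (X in is_derive _ _ X); have -> : l = Cmult s (RtoC (- / (1 - x))).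
  by rewrite /l scal_C Cmult_comm.
apply: (is_derive_ext (K := R_AbsRing) (V := C_R_NormedModule)) => t.
by rewrite scal_C Cmult_comm.
Qed.

(** * Growth of the exponent and decay of the integrand *)

Lemma sum_n_Rle (u v : nat -> R) (n : nat) :
  (forall k, (k <= n)%coq_nat -> u k <= v k) -> sum_n u n <= sum_n v n.
Proof. by rewrite !sum_n_Reals; exact: sum_Rle. Qed.

(** This is [ln (e t) <= e t]. The slope [e] may be arbitrarily small, so the logarithm can be
    absorbed by a small part of the leading term. *)
Lemma ln_le_linear (e t : R) : 0 < e -> 0 < t -> ln t <= e * t - ln e.
Proof.
move=> e0 t0.
have : ln (e * t) <= e * t.
  rewrite -[X in _ <= X]ln_exp; apply: ln_le; first exact: Rmult_lt_0_compat.
  by have := exp_ineq1_le (e * t); lra.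
by rewrite ln_mult //; lra.
Qed.

Lemma poly_bound_below_degree (r : nat -> R) (n : nat) (x : R) :
  sum_n (fun k => r k * x ^ k) n <= sum_n (fun k => Rabs (r k)) n * (1 + Rabs x ^ n).
Proof.
rewrite Rmult_comm -sum_n_Rmult_l; apply: sum_n_Rle => k kn.
have : r k * x ^ k <= Rabs (r k) * Rabs x ^ k.
  by rewrite RPow_abs -Rabs_mult; exact: Rle_abs.
suff : Rabs x ^ k <= 1 + Rabs x ^ n.
  by have := Rabs_pos (r k); nra.
have xn := pow_le _ n (Rabs_pos x).
case: (Rle_dec 1 (Rabs x)) => H; first by have := Rle_pow _ _ _ H kn; lra.
have : Rabs x ^ k <= 1 ^ k by apply: pow_incr; have := Rabs_pos x; lra.
by rewrite pow1; lra.
Qed.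

(** With [y = |x|] the leading term is [-al y^(n+1)]. One half of it absorbs the logarithm, the
    other half the terms of lower degree. *)
Lemma exponent_bounded (r : nat -> R) (sigma : R) (n : nat) :
  (-1) ^ n.+1 * r n.+1 < 0 ->
  exists B, forall x, x <= 0 ->
    sigma * ln (1 - x) + sum_n (fun k => r k * x ^ k) n.+1 <= B.
Proof.
move=> rn; set al := - ((-1) ^ n.+1 * r n.+1).
set A : R := sum_n (fun k => Rabs (r k)) n.
have A0 : 0 <= A.
  rewrite /A -[X in X <= _](Rmult_0_r (INR n.+1)) -sum_n_const.
  by apply: sum_n_Rle => k _; exact: Rabs_pos.
have s0 := Rabs_pos sigma.
(* Chosen so that [|sigma| e <= al / 2]; the [+ 1] keeps the denominator positive when
   [sigma = 0]. *)
set e := al / 2 / (Rabs sigma + 1).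
have al0 : 0 < al by rewrite /al; lra.
have e0 : 0 < e by apply: Rdiv_lt_0_compat; lra.
have se : Rabs sigma * e <= al / 2.
  have -> : al / 2 = (Rabs sigma + 1) * e by rewrite /e; field; lra.
  by apply: Rmult_le_compat_r; lra.
(* The first [A] comes from the lower terms. The next two summands come from the logarithm, using
   [y <= 1 + y^(n+1)]. The last bounds [A y^n - al/2 y^(n+1)], which is at most zero once
   [y >= 2A/al]. *)
exists (A + Rabs sigma * Rabs (ln e) + al + A * (2 * A / al) ^ n) => x x0.
set y := Rabs x; have yE : y = - x by rewrite /y Rabs_left1.
have y0 : 0 <= y by lra.
have H1 : sigma * ln (1 - x) <= al / 2 * (1 + y) + Rabs sigma * Rabs (ln e).
  have l0 : 0 <= ln (1 - x) by rewrite -ln_1; apply: ln_le; lra.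
  have l1 := ln_le_linear e (1 - x) e0 ltac:(lra).
  have := Rle_abs (- ln e); rewrite Rabs_Ropp => l2.
  have l3 : sigma * ln (1 - x) <= Rabs sigma * ln (1 - x).
    by apply: Rmult_le_compat_r => //; exact: Rle_abs.
  have l4 : Rabs sigma * ln (1 - x) <= Rabs sigma * (e * (1 + y) + Rabs (ln e)).
    by apply: Rmult_le_compat_l => //; rewrite yE; lra.
  by nra.
have H2 : r n.+1 * x ^ n.+1 = - al * y ^ n.+1.
  rewrite /al (_ : x = -1 * y); last by rewrite yE; ring.
  rewrite Rpow_mult_distr.
  have -> : (-1) ^ n.+1 * r n.+1 = r n.+1 * (-1) ^ n.+1 by ring.
  ring.
have H3 : sum_n (fun k => r k * x ^ k) n.+1 <= A * (1 + y ^ n) - al * y ^ n.+1.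
  rewrite sum_Sn /plus /= -/(x ^ n.+1) -/(y ^ n.+1).
  have := poly_bound_below_degree r n x; rewrite -/A -/y.
  by have := H2; rewrite /=; lra.
have H4 : y <= 1 + y ^ n.+1.
  case: (Rle_dec 1 y) => H; last by have := pow_le _ n.+1 y0; lra.
  by have := Rle_pow _ 1 n.+1 H ltac:(lia); rewrite pow_1; lra.
suff H5 : A * y ^ n - al / 2 * y ^ n.+1 <= A * (2 * A / al) ^ n.
  by nra.
have yn := pow_le _ n y0.
case: (Rle_dec (2 * A / al) y) => H.
  have : 0 <= A * (2 * A / al) ^ n.
    apply: Rmult_le_pos => //; apply: pow_le; apply: Rmult_le_pos; first lra.
    by apply: Rlt_le; exact: Rinv_0_lt_compat.
  have : A <= al / 2 * y.
    by have -> : A = al / 2 * (2 * A / al); [field; lra | apply: Rmult_le_compat_l; lra].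
  by rewrite /=; nra.
have : A * y ^ n <= A * (2 * A / al) ^ n.
  by apply: Rmult_le_compat_l => //; apply: pow_incr; lra.
by have := pow_le _ n.+1 y0; nra.
Qed.

Lemma PhiC_integrand_bounded (n : nat) (a : nat -> C) (s : C) : (1 <= n)%N ->
  (-1) ^ n * Re (a n) < 0 ->
  exists M, forall x, x <= 0 -> Cmod (PhiC_integrand n a s x) <= M.
Proof.
case: n => // n _ an.
have [B HB] := exponent_bounded (fun k => Re (a k)) (Re s) n an.
exists (exp B) => x x0; rewrite PhiC_integrandE Cmod_cexp.
have H := HB x x0; set z := Re _.
suff -> : z = Re s * ln (1 - x) + sum_n (fun k => Re (a k) * x ^ k) n.+1.
  by case: H => [H|->]; [apply: Rlt_le; apply: exp_increasing | apply: Rle_refl].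
rewrite /z (_ : forall u v, Re (Cplus u v) = Re u + Re v) // Re_mul_RtoC.
congr Rplus; rewrite /fC Re_sum_n; apply: sum_n_ext => k.
by rewrite pow_n_RtoC Re_mul_RtoC.
Qed.

(** Boundedness at the exponent [s + m], divided by [(1-x)^m]. *)
Lemma PhiC_integrand_decay (n : nat) (a : nat -> C) (s : C) (m : nat) : (1 <= n)%N ->
  (-1) ^ n * Re (a n) < 0 ->
  exists M, forall x, x <= 0 -> Cmod (PhiC_integrand n a s x) <= M / (1 - x) ^ m.
Proof.
move=> n1 an.
have [M HM] := PhiC_integrand_bounded n a (Cplus s (RtoC (INR m))) n1 an.
exists M => x x0; have := HM x x0.
rewrite PhiC_integrand_shift // Cmod_mult Cmod_R.
have P : 0 < (1 - x) ^ m by apply: pow_lt; lra.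
rewrite Rabs_pos_eq; last lra.
move=> H; apply: (Rmult_le_reg_l ((1 - x) ^ m)) => //.
by have -> : (1 - x) ^ m * (M / (1 - x) ^ m) = M by field; lra.
Qed.

(** * Improper integrals of complex-valued functions *)

Lemma norm_C_R (z : C) : norm (z : C_R_NormedModule) = Cmod z.
Proof.
rewrite /norm /= /prod_norm /norm /= /abs /= /Cmod.
by congr sqrt; rewrite /= !Rmult_1_r -!Rabs_mult !Rabs_pos_eq //; apply: Rle_0_sqr.
Qed.

(** The filter [at_point 0] pins the upper endpoint to zero, so only the limit in the lower endpoint
    remains. *)
Lemma is_RInt_gen_of_lim (V : NormedModule R_AbsRing) (f F : R -> V) (l : V) :
  (forall b, b <= 0 -> is_RInt f b 0 (F b)) ->
  filterlim F (Rbar_locally m_infty) (locally l) ->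
  is_RInt_gen f (Rbar_locally m_infty) (at_point 0) l.
Proof.
move=> HF Hl P HP.
have [M HM] := Hl P HP.
apply: (Filter_prod _ _ _ (fun b => b < Rmin M 0) (fun c => c = 0)).
- by exists (Rmin M 0).
- by [].
- move=> b c Hb -> /=; exists (F b).
  have := Rmin_l M 0; have := Rmin_r M 0 => h1 h2.
  by split; [apply: HF; lra | apply: HM; lra].
Qed.

(** Cauchy criterion at minus infinity: comparison with the primitive [M/(1-x)] of the bound gives
    at most [M/(1-v)] for the integral over [[u, v]]. *)
Lemma ex_RInt_gen_of_decay (f : R -> C) (M : R) :
  (forall x, x <= 0 -> continuous (f : R -> C_R_NormedModule) x) ->
  (forall x, x <= 0 -> Cmod (f x) <= M / (1 - x) ^ 2) ->
  exists l : C, @is_RInt_gen C_R_NormedModule f (Rbar_locally m_infty) (at_point 0) l.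
Proof.
move=> fc fM.
have M0 : 0 <= M.
  have := fM 0 (Rle_refl 0); have := Cmod_ge_0 (f 0).
  by rewrite Rminus_0_r pow1 /Rdiv Rinv_1; lra.
pose F (b : R) : C_R_CompleteNormedModule := RInt (V := C_R_CompleteNormedModule) f b 0.
have exI u v : u <= v <= 0 -> ex_RInt (V := C_R_CompleteNormedModule) f u v.
  move=> uv; apply: (ex_RInt_continuous (V := C_R_CompleteNormedModule)) => z.
  by rewrite Rmax_right; [move=> Hz; apply: fc; lra | lra].
have HF b : b <= 0 -> is_RInt (V := C_R_NormedModule) f b 0 (F b).
  by move=> b0; apply: (RInt_correct (V := C_R_CompleteNormedModule)); apply: exI; lra.
suff [l Hl] : exists l : C_R_CompleteNormedModule, filterlim F (Rbar_locally m_infty) (locally l).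
  by exists l; apply: (is_RInt_gen_of_lim C_R_NormedModule f F).
have key u v : u <= v <= 0 -> norm (minus (F u) (F v)) <= M / (1 - v).
  move=> uv.
  have I : is_RInt (V := C_R_NormedModule) f u v (minus (F u) (F v)).
    rewrite /minus; apply: (is_RInt_Chasles _ _ 0); first by apply: HF; lra.
    by apply: is_RInt_swap; apply: HF; lra.
  have J : is_RInt (fun x => M / (1 - x) ^ 2) u v (M / (1 - v) - M / (1 - u)).
    change (is_RInt (fun x => M / (1 - x) ^ 2) u v (minus (M / (1 - v)) (M / (1 - u)))).
    apply: (is_RInt_derive (V := R_CompleteNormedModule) (fun x => M / (1 - x))) => x;
      rewrite Rmax_right; try lra; move=> Hx.
    - by auto_derive; [lra | field; lra].
    - apply: ex_derive_continuous; eexists; auto_derive; last reflexivity.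
      by rewrite Rmult_1_r; nra.
  have := norm_RInt_le _ _ _ _ _ _ (proj1 uv) _ I J.
  have : 0 <= M / (1 - u).
    by apply: Rmult_le_pos => //; apply: Rlt_le; apply: Rinv_0_lt_compat; lra.
  move=> h H; apply: Rle_trans (H _) _.
    by move=> x Hx; rewrite norm_C_R; apply: fM; lra.
  by lra.
apply/filterlim_locally_cauchy => eps.
have ep := cond_pos eps.
have key2 u v : u <= v < - (M / eps) -> ball (F u) eps (F v).
  move=> uv.
  have Me : 0 <= M / eps by apply: Rmult_le_pos => //; apply: Rlt_le; apply: Rinv_0_lt_compat.
  apply: ball_sym; apply: norm_compat1; apply: Rle_lt_trans (key u v _) _; first lra.
  apply: (Rmult_lt_reg_l (1 - v)); first lra.
  have -> : (1 - v) * (M / (1 - v)) = M by field; lra.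
  have -> : M = M / eps * eps by field; lra.
  by apply: Rmult_lt_compat_r; lra.
(* For [v < -M/eps] one has [(1 - v) eps > M], that is [M/(1-v) < eps]. *)
exists (fun b => b < - (M / eps)); split; first by exists (- (M / eps)).
move=> u v Hu Hv; case: (Rle_dec u v) => H; first by apply: key2; lra.
by apply: ball_sym; apply: key2; lra.
Qed.

(** [C_R_NormedModule] is a module over the reals, so a complex constant acts as a bounded linear
    map and not as a scalar. *)
Lemma is_linear_Cmult (c : C) :
  @is_linear R_AbsRing C_R_NormedModule C_R_NormedModule (Cmult c).
Proof.
split.
- by move=> x y; exact: Cmult_plus_distr_l.
- move=> k x; rewrite !scal_C; Cring.
- exists (Cmod c + 1); split; first by have := Cmod_ge_0 c; lra.
  move=> x; rewrite !norm_C_R Cmod_mult.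
  by apply: Rmult_le_compat_r; [exact: Cmod_ge_0 | lra].
Qed.

Lemma is_RInt_Cmult (f : R -> C) (a b : R) (c l : C) :
  @is_RInt C_R_NormedModule f a b l ->
  @is_RInt C_R_NormedModule (fun x => Cmult c (f x)) a b (Cmult c l).
Proof.
move=> H.
have h1 := is_RInt_fct_extend_fst _ _ _ _ H.
have h2 := is_RInt_fct_extend_snd _ _ _ _ H.
apply: is_RInt_fct_extend_pair => /=.
- exact: (is_RInt_minus (V := R_NormedModule) _ _ _ _ _ _ (is_RInt_scal _ _ _ c.1 _ h1)
    (is_RInt_scal _ _ _ c.2 _ h2)).
- exact: (is_RInt_plus (V := R_NormedModule) _ _ _ _ _ _ (is_RInt_scal _ _ _ c.1 _ h2)
    (is_RInt_scal _ _ _ c.2 _ h1)).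
Qed.

Lemma is_RInt_gen_Cmult (f : R -> C) (Fa Fb : (R -> Prop) -> Prop) {FFa : Filter Fa}
    {FFb : Filter Fb} (c l : C) :
  @is_RInt_gen C_R_NormedModule f Fa Fb l ->
  @is_RInt_gen C_R_NormedModule (fun x => Cmult c (f x)) Fa Fb (Cmult c l).
Proof.
move=> H P HP.
have Q := H _
  (linear_cont (Cmult c : C_R_NormedModule -> C_R_NormedModule) l (is_linear_Cmult c) P HP).
rewrite /filtermapi in Q *; apply: filter_imp Q => ab [y [Hy1 Hy2]].
by exists (Cmult c y); split => //; apply: is_RInt_Cmult.
Qed.

Lemma is_RInt_gen_sum_n (V : NormedModule R_AbsRing) (Fa Fb : (R -> Prop) -> Prop)
    {FFa : Filter Fa} {FFb : Filter Fb} (f : nat -> R -> V) (l : nat -> V) (n : nat) :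
  (forall k, is_RInt_gen (f k) Fa Fb (l k)) ->
  is_RInt_gen (fun x => sum_n (fun k => f k x) n) Fa Fb (sum_n l n).
Proof.
move=> H; elim: n => [|n IH].
  rewrite sum_O; apply: is_RInt_gen_ext (H 0%N).
  by apply: filter_forall => ab x _; rewrite sum_O.
rewrite sum_Sn; apply: is_RInt_gen_ext (is_RInt_gen_plus _ _ _ _ IH (H n.+1)).
by apply: filter_forall => ab x _; rewrite sum_Sn.
Qed.

(** * Convergence of the integral and the complex recurrence *)

Lemma PhiC_integrand_continuous (n : nat) (a : nat -> C) (s : C) (x : R) : (1 <= n)%N -> x <= 0 ->
  continuous (PhiC_integrand n a s : R -> C_R_NormedModule) x.
Proof.
move=> n1 x0; apply: (ex_derive_continuous (V := C_R_NormedModule)).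
by eexists; exact: is_derive_PhiC_integrand.
Qed.

Lemma PhiC_integrand_cvg0 (n : nat) (a : nat -> C) (s : C) : (1 <= n)%N ->
  (-1) ^ n * Re (a n) < 0 ->
  filterlim (PhiC_integrand n a s) (Rbar_locally m_infty) (locally (RtoC 0 : C_R_NormedModule)).
Proof.
move=> n1 an; have [M HM] := PhiC_integrand_decay n a s 1 n1 an.
apply/(filterlim_locally (U := C_R_NormedModule)) => eps.
have ep := cond_pos eps.
exists (Rmin 0 (- (M / eps))) => x Hx.
have := Rmin_l 0 (- (M / eps)); have := Rmin_r 0 (- (M / eps)) => h1 h2.
apply: norm_compat1; rewrite /minus opp_zero plus_zero_r norm_C_R.
apply: Rle_lt_trans (HM x _) _; first lra.
rewrite pow_1; apply: (Rmult_lt_reg_l (1 - x)); first lra.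
have -> : (1 - x) * (M / (1 - x)) = M by field; lra.
have -> : M = M / eps * eps by field; lra.
by apply: Rmult_lt_compat_r; lra.
Qed.

Lemma PhiC_cvg (n : nat) (a : nat -> C) (s : C) : (1 <= n)%N ->
  (-1) ^ n * Re (a n) < 0 ->
  exists l : C, @is_RInt_gen C_R_NormedModule (PhiC_integrand n a s)
    (Rbar_locally m_infty) (at_point 0) l.
Proof.
move=> n1 an; have [M HM] := PhiC_integrand_decay n a s 2 n1 an.
by apply: ex_RInt_gen_of_decay HM => x; exact: PhiC_integrand_continuous.
Qed.

Lemma PhiC_correct (n : nat) (a : nat -> C) (s : C) : (1 <= n)%N ->
  (-1) ^ n * Re (a n) < 0 ->
  @is_RInt_gen C_R_NormedModule (PhiC_integrand n a s) (Rbar_locally m_infty) (at_point 0)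
    (PhiC n a s).
Proof.
move=> n1 an; have [l Hl] := PhiC_cvg n a s n1 an.
by rewrite /PhiC (is_RInt_gen_unique (V := C_R_CompleteNormedModule) _ _ Hl).
Qed.

Lemma phiC_derive (n : nat) (a : nat -> C) (x : R) : (1 <= n)%N ->
  @is_derive R_AbsRing C_R_NormedModule (phiC n a) x
    (sum_n (fun m => Cmult (Cmult (RtoC ((-1) ^ m)) (cC n a m))
                           (Cmult (RtoC ((1 - x) ^ m)) (phiC n a x))) n.-1).
Proof.
move=> n1.
have -> : sum_n (fun m => Cmult (Cmult (RtoC ((-1) ^ m)) (cC n a m))
            (Cmult (RtoC ((1 - x) ^ m)) (phiC n a x))) n.-1
  = Cmult (dfC n a x) (phiC n a x).
  rewrite dfC_expand // Cmult_comm -sum_n_Cmult_l; apply: sum_n_ext => m; Cring.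
exact: is_derive_phiC.
Qed.

Lemma PhiC_recurrence (n : nat) (a : nat -> C) (s : C) : (1 <= n)%N ->
  (-1) ^ n * Re (a n) < 0 ->
  Cplus (cexp (a 0%N)) (Cmult s (PhiC n a (Cminus s (RtoC 1)))) =
  sum_n (fun m => Cmult (Cmult (RtoC ((-1) ^ m)) (cC n a m))
                        (PhiC n a (Cplus s (RtoC (INR m))))) n.-1.
Proof.
move=> n1 an.
(* [I] is the derivative of the integrand. Its integral is computed by linearity in [H1] and by the
   fundamental theorem of calculus in [H2]. *)
pose I := fun (x : R) => Cplus (Cmult (Copp s) (PhiC_integrand n a (Cminus s (RtoC 1)) x))
      (sum_n (fun m => Cmult (Cmult (RtoC ((-1) ^ m)) (cC n a m))
                             (PhiC_integrand n a (Cplus s (RtoC (INR m))) x)) n.-1).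
have H1 : @is_RInt_gen C_R_NormedModule I (Rbar_locally m_infty) (at_point 0)
   (Cplus (Cmult (Copp s) (PhiC n a (Cminus s (RtoC 1))))
     (sum_n (fun m => Cmult (Cmult (RtoC ((-1) ^ m)) (cC n a m))
                        (PhiC n a (Cplus s (RtoC (INR m))))) n.-1)).
  apply: (is_RInt_gen_plus (V := C_R_NormedModule)).
    by apply: is_RInt_gen_Cmult; exact: PhiC_correct.
  apply: (is_RInt_gen_sum_n C_R_NormedModule) => m.
  by apply: is_RInt_gen_Cmult; exact: PhiC_correct.
have cont_Cmult c t x : x <= 0 ->
    continuous (fun y => Cmult c (PhiC_integrand n a t y) : C_R_NormedModule) x.
  move=> x0; apply: (continuous_comp (V := C_R_NormedModule) (W := C_R_NormedModule)).
    exact: PhiC_integrand_continuous.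
  exact: (linear_cont (Cmult c : C_R_NormedModule -> C_R_NormedModule) _ (is_linear_Cmult c)).
have Ic x : x <= 0 -> continuous (I : R -> C_R_NormedModule) x.
  move=> x0; apply: (continuous_plus (V := C_R_NormedModule)); first exact: cont_Cmult.
  elim: n.-1 => [|k IH].
    apply: (continuous_ext (U := C_R_NormedModule)) (cont_Cmult _ _ x x0).
    by move=> y; rewrite sum_O.
  apply: (continuous_ext (U := C_R_NormedModule)); first by move=> y; rewrite sum_Sn.
  by apply: (continuous_plus (V := C_R_NormedModule)) IH _; exact: cont_Cmult.
have H2 : @is_RInt_gen C_R_NormedModule I (Rbar_locally m_infty) (at_point 0)
   (PhiC_integrand n a s 0).
  (* The integral over [[b, 0]] is the increment of the integrand, whose value at [b] tends to zero;
     only the value at zero survives. *)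
  apply: (is_RInt_gen_of_lim C_R_NormedModule _
     (fun b => minus (PhiC_integrand n a s 0 : C_R_NormedModule) (PhiC_integrand n a s b))).
    move=> b b0; apply: (is_RInt_derive (V := C_R_CompleteNormedModule)) => x;
      rewrite Rmax_right // => Hx; last by apply: Ic; lra.
    by apply: is_derive_PhiC_integrand => //; lra.
  move: (PhiC_integrand n a s 0) => z.
  have L : filterlim (fun b => minus (z : C_R_NormedModule) (PhiC_integrand n a s b))
      (Rbar_locally m_infty) (locally (plus (z : C_R_NormedModule)
        (Hierarchy.opp (RtoC 0 : C_R_NormedModule)))).
    have L1 : filterlim (fun b => Hierarchy.opp (PhiC_integrand n a s b : C_R_NormedModule))
        (Rbar_locally m_infty) (locally (Hierarchy.opp (RtoC 0 : C_R_NormedModule))).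
      apply: filterlim_comp; first exact: PhiC_integrand_cvg0.
      exact: (@filterlim_opp R_AbsRing C_R_NormedModule).
    apply: (filterlim_comp_2 _ _ plus (filterlim_const (z : C_R_NormedModule)) L1).
    exact: (@filterlim_plus R_AbsRing C_R_NormedModule).
  by rewrite opp_zero plus_zero_r in L.
have := is_RInt_gen_unique (V := C_R_CompleteNormedModule) _ _ H1.
rewrite (is_RInt_gen_unique (V := C_R_CompleteNormedModule) _ _ H2) => E.
(* At [x = 0] the power [(1-x)^s] is one and [f] reduces to [a 0]. *)
have E0 : cexp (a 0%N) = PhiC_integrand n a s 0.
  rewrite PhiC_integrandE Rminus_0_r ln_1 Cmult_0_r Cplus_0_l; congr cexp.
  rewrite /fC; case: {H1 Ic cont_Cmult H2 E I an} n n1 => // n _.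
  rewrite /sum_n sum_Sn_m; last lia.
  rewrite -sum_n_m_S Cmult_1_r (sum_n_m_ext _ (fun _ => RtoC 0)).
    by rewrite (sum_n_m_const_zero (G := C_AbelianMonoid)) [plus _ _]Cplus_0_r.
  by move=> k; rewrite pow_n_RtoC /= Rmult_0_l Cmult_0_r.
by rewrite E0 E; Cring.
Qed.
End ComplexExponential.

(** * The p-adic case *)

Delimit Scope R_scope with coqR.

(** The extra bound [e <= 1] serves products of continuous functions, where a nearby value of a
    factor must stay below a fixed [M]. *)
Lemma small_factor (M eps : R) : (0 <= M)%coqR -> (0 < eps)%coqR ->
  exists2 e : R, (0 < e <= 1)%coqR & (e * M < eps)%coqR.
Proof.
move=> M0 e0; exists (Rmin 1 (eps / (M + 1)))%coqR.
  by split; [apply: Rmin_pos; [lra | apply: Rdiv_lt_0_compat; lra] | exact: Rmin_l].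
apply: Rle_lt_trans (_ : (eps / (M + 1) * M < eps)%coqR).
  by apply: Rmult_le_compat_r; [lra | exact: Rmin_r].
rewrite -[X in (_ < X)%coqR](_ : (eps / (M + 1) * (M + 1) = eps)%coqR); last by field; lra.
by apply: Rmult_lt_compat_l; [apply: Rdiv_lt_0_compat; lra | lra].
Qed.

(* From here on, [ring] is the MathComp tactic; [ring] and [field] above are those
   of the real and complex numbers. *)
From mathcomp Require Import ring zify.

(** * The formal exponential of a polynomial *)

Section FormalODE.
Variable F : fieldType.
Hypothesis char0 : forall n : nat, n.+1%:R != 0 :> F.

(** Stands in for a power series: if [g] has no constant term, the coefficient of degree [N] in
    [exp g] is already that of the truncation at [N]. *)
Definition exp_trunc (g : {poly F}) (N : nat) : {poly F} :=
  \sum_(k < N.+1) (k`!%:R)^-1 *: g ^+ k.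

Lemma factF_neq0 (k : nat) : k`!%:R != 0 :> F.
Proof. by case: k`! (fact_gt0 k). Qed.

Lemma coef_expn_low (g : {poly F}) (k N : nat) : g`_0 = 0 -> (N < k)%N -> (g ^+ k)`_N = 0.
Proof.
move=> g0; elim: k N => // k IH N Nk.
rewrite exprS coefM big1 // => -[[|j] /= Hj] _; first by rewrite g0 mul0r.
by rewrite IH ?mulr0 //; lia.
Qed.

Lemma coef_exp_trunc (g : {poly F}) (N M : nat) : g`_0 = 0 -> (N <= M)%N ->
  (exp_trunc g M)`_N = (exp_trunc g N)`_N.
Proof.
move=> g0 NM; rewrite /exp_trunc !coef_sum.
rewrite -!(big_mkord xpredT (fun k => ((k`!%:R)^-1 *: g ^+ k)`_N)).
rewrite (@big_cat_nat _ _ _ N.+1) //= [X in _ + X]big_nat [X in _ + X]big1 ?addr0 //.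
move=> k /andP[Nk _].
by rewrite coefZ coef_expn_low // mulr0.
Qed.

Lemma deriv_exp_trunc (g : {poly F}) (N : nat) :
  (exp_trunc g N.+1)^`() = g^`() * exp_trunc g N.
Proof.
rewrite /exp_trunc big_ord_recl /= expr0 derivD derivZ derivC scaler0 add0r.
rewrite raddf_sum mulr_sumr; apply: eq_bigr => k _.
rewrite /= derivZ deriv_exp /bump add1n /= -scaler_nat scalerA -scalerAr; congr (_ *: _).
by rewrite factS natrM invfM mulrAC mulVf ?mul1r.
Qed.

(* The power series G = exp g satisfies G' = g' G, read off coefficientwise. *)
Lemma coef_exp_trunc_rec (g : {poly F}) (N : nat) : g`_0 = 0 ->
  N.+1%:R * (exp_trunc g N.+1)`_N.+1 =
  \sum_(j < N.+1) j.+1%:R * g`_j.+1 * (exp_trunc g (N - j))`_(N - j).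
Proof.
move=> g0; have := congr1 (fun q : {poly F} => q`_N) (deriv_exp_trunc g N).
rewrite coef_deriv coefM mulr_natl => ->; apply: eq_bigr => j _.
by rewrite coef_deriv coef_exp_trunc ?leq_subr // mulr_natl.
Qed.
End FormalODE.

(** * Falling factorials, binomial coefficients and iterated differences *)

Section FallingFactorial.
Variable F : closedFieldType.
Hypothesis char0 : forall n : nat, n.+1%:R != 0 :> F.

Definition ffallK (x : F) (n : nat) : F := \prod_(i < n) (x - i%:R).

Lemma fact_binomK (x : F) (n : nat) : n`!%:R * binomK x n = ffallK x n.
Proof. by rewrite /binomK mulrC divfK // factF_neq0. Qed.

Lemma ffallKS (x : F) (n : nat) : ffallK x n.+1 = ffallK x n * (x - n%:R).
Proof. exact: big_ord_recr. Qed.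

Lemma ffallKD (x : F) (k j : nat) : ffallK x (k + j) = ffallK x k * ffallK (x - k%:R) j.
Proof.
elim: j => [|j IH]; first by rewrite addn0 /ffallK big_ord0 mulr1.
by rewrite addnS !ffallKS IH natrD opprD addrA mulrA.
Qed.

Lemma ffallK1 (x : F) : ffallK x 1 = x.
Proof. by rewrite /ffallK big_ord1 subr0. Qed.

Lemma ffallKS_l (x : F) (n : nat) : ffallK x n.+1 = x * ffallK (x - 1) n.
Proof. by rewrite -[n.+1]add1n ffallKD ffallK1. Qed.

Lemma binomK0 (x : F) : binomK x 0 = 1.
Proof. by rewrite /binomK big_ord0 divr1. Qed.

(** Pascal's rule for an arbitrary upper argument; multiplied by [(n+1)!] it becomes an identity of
    falling factorials. *)
Lemma binomKS (x : F) (n : nat) : binomK (x + 1) n.+1 = binomK x n + binomK x n.+1.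
Proof.
apply: (mulfI (factF_neq0 _ char0 n.+1)).
rewrite mulrDr !fact_binomK ffallKS_l addrK ffallKS factS natrM -mulrA fact_binomK.
by rewrite -natr1; ring.
Qed.

Lemma binomK_nat (N n : nat) : binomK (N%:R : F) n = 'C(N, n)%:R.
Proof.
elim: N n => [|N IH] [|n]; rewrite ?binomK0 ?bin0 //.
  by rewrite /binomK big_ord_recl subrr mul0r mul0r bin0n.
by rewrite -natr1 binomKS !IH binS natrD addrC.
Qed.

Lemma ffallKN1 (n : nat) : ffallK (-1 : F) n = (-1) ^+ n * n`!%:R.
Proof.
elim: n => [|n IH]; first by rewrite /ffallK big_ord0 mulr1.
by rewrite ffallKS IH factS natrM exprS -natr1; ring.
Qed.

(** The alternating sum is the [j]-th iterate of [P(m) - P(m+1)] taken at zero; by Pascal's rule one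
    more iterate is the difference of two shifted ones. *)
Lemma sum_binom_diff (P : nat -> F) (j : nat) :
  \sum_(m < j.+2) (-1) ^+ m * 'C(j.+1, m)%:R * P m =
  \sum_(m < j.+1) (-1) ^+ m * 'C(j, m)%:R * P m -
  \sum_(m < j.+1) (-1) ^+ m * 'C(j, m)%:R * P m.+1.
Proof.
rewrite big_ord_recl /= bin0 [X in _ = X - _](_ : _ =
  \sum_(m < j.+2) (-1) ^+ m * 'C(j, m)%:R * P m); last first.
  by rewrite [RHS]big_ord_recr /= bin_small // mulr0 mul0r addr0.
rewrite [X in _ = X - _]big_ord_recl /= bin0 -addrA; congr (_ + _).
rewrite -sumrB; apply: eq_bigr => m _.
by rewrite /bump add1n binS natrD exprS; ring.
Qed.

(** Set [k = j + 1]. As ['C(j, m) = 0] for [j < m], the range of [j] can be made independent of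
    [m]. *)
Lemma cK_sum (n : nat) (a : nat -> F) (m : nat) :
  cK n a m = \sum_(j < n) j.+1%:R * a j.+1 * 'C(j, m)%:R.
Proof.
rewrite /cK big_add1 /= -(big_mkord xpredT (fun j => j.+1%:R * a j.+1 * 'C(j, m)%:R)).
have E : forall k, (k.+1 * 'C(k, m))%:R * a k.+1 = k.+1%:R * a k.+1 * 'C(k, m)%:R.
  by move=> k; rewrite natrM mulrAC.
have [mn|nm] := leqP m n.
  rewrite [RHS](@big_cat_nat _ _ _ m) //= [X in _ = X + _]big_nat [X in _ = X + _]big1 ?add0r.
    by apply: eq_bigr => k _; exact: E.
  by move=> k /andP[_ km]; rewrite bin_small // mulr0.
rewrite big_geq ?(ltnW nm) // big_nat big1 // => k /andP[_ kn].
by rewrite bin_small ?mulr0 //; exact: ltn_trans nm.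
Qed.

(** Exchanging the sums turns a combination with the [c_m] into one of iterated differences weighted
    by the coefficients of [f']. *)
Lemma sum_cK (n : nat) (a P : nat -> F) :
  \sum_(m < n) (-1) ^+ m * cK n a m * P m =
  \sum_(j < n) j.+1%:R * a j.+1 * \sum_(m < j.+1) (-1) ^+ m * 'C(j, m)%:R * P m.
Proof.
under eq_bigr => m _ do rewrite cK_sum mulr_sumr mulr_suml.
rewrite exchange_big /=; apply: eq_bigr => j _.
rewrite mulr_sumr -(big_mkord xpredT (fun m => j.+1%:R * a j.+1 * ((-1) ^+ m * 'C(j, m)%:R * P m))).
rewrite (big_nat_widen _ _ n) ?ltn_ord // big_mkord [RHS]big_mkcond /=.
apply: eq_bigr => m _; case: ltnP => jm; first by ring.
by rewrite bin_small // !(mulr0, mul0r).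
Qed.
End FallingFactorial.

(** * The absolute value of C_p *)

Section PadicAnalysis.
Variables (K : closedFieldType) (absv : K -> R) (p : nat).
Hypothesis Cp : is_Cp absv p.

Lemma absv_ge0 (x : K) : (0 <= absv x)%coqR.
Proof. by case: Cp => [[_ H _ _ _] _]; case: (H x). Qed.

Lemma absv_eq0 (x : K) : absv x = 0%coqR -> x = 0.
Proof. by case: Cp => [[_ H _ _ _] _] E; apply/(proj2 (H x)). Qed.

Lemma absv0 : absv 0 = 0%coqR.
Proof. by case: Cp => [[_ H _ _ _] _]; apply/(proj2 (H 0)). Qed.

Lemma absvM (x y : K) : absv (x * y) = (absv x * absv y)%coqR.
Proof. by case: Cp => [[_ _ H _ _] _]. Qed.

Lemma absvD_le (x y : K) (B : R) :
  (absv x <= B)%coqR -> (absv y <= B)%coqR -> (absv (x + y) <= B)%coqR.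
Proof.
move=> hx hy; case: Cp => [[_ _ _ H _] _]; apply: Rle_trans (H x y) _.
exact: Rmax_lub.
Qed.

Lemma absvD_lt (x y : K) (B : R) :
  (absv x < B)%coqR -> (absv y < B)%coqR -> (absv (x + y) < B)%coqR.
Proof.
move=> hx hy; case: Cp => [[_ _ _ H _] _]; apply: Rle_lt_trans (H x y) _.
exact: Rmax_lub_lt.
Qed.

Lemma p_gt1 : (1 < p)%N.
Proof. by case: Cp => [[/prime_gt1]]. Qed.

Lemma absv_p : absv p%:R = (/ INR p)%coqR.
Proof. by case: Cp => [[]]. Qed.

Lemma absv_p_bounds : (0 < absv p%:R < 1)%coqR.
Proof.
have h : (1 < INR p)%coqR by apply: (lt_INR 1); apply/ltP; exact: p_gt1.
rewrite absv_p; split; first by apply: Rinv_0_lt_compat; lra.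
by rewrite -Rinv_1; apply: Rinv_lt_contravar; lra.
Qed.

Lemma absv1 : absv 1 = 1%coqR.
Proof.
have h : absv 1 <> 0%coqR by move=> /absv_eq0 /eqP; rewrite oner_eq0.
by apply: (Rmult_eq_reg_l (absv 1)) => //; rewrite -absvM mulr1 Rmult_1_r.
Qed.

Lemma absvN (x : K) : absv (- x) = absv x.
Proof.
rewrite -mulN1r absvM.
have : (absv (-1) * absv (-1) = 1)%coqR by rewrite -absvM mulrNN mulr1 absv1.
have := absv_ge0 (-1) => h0 h.
have -> : absv (-1) = 1%coqR by nra.
by rewrite Rmult_1_l.
Qed.

Lemma absvB_lt (x y : K) (B : R) :
  (absv x < B)%coqR -> (absv y < B)%coqR -> (absv (x - y) < B)%coqR.
Proof. by move=> hx hy; apply: absvD_lt; rewrite ?absvN. Qed.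

Lemma absvB_sym (x y : K) : absv (x - y) = absv (y - x).
Proof. by rewrite -absvN opprB. Qed.

Lemma absv_nat (n : nat) : (absv n%:R <= 1)%coqR.
Proof.
elim: n => [|n IH]; first by rewrite absv0; lra.
by rewrite -natr1; apply: absvD_le; rewrite ?absv1; lra.
Qed.

Lemma absv_sign (n : nat) : absv ((-1) ^+ n) = 1%coqR.
Proof.
elim: n => [|n IH]; first by rewrite expr0 absv1.
by rewrite exprS mulN1r absvN.
Qed.

Lemma absv_sum_le (I : Type) (r : seq I) (P : pred I) (F : I -> K) (B : R) :
  (0 <= B)%coqR -> (forall i, P i -> absv (F i) <= B)%coqR ->
  (absv (\sum_(i <- r | P i) F i) <= B)%coqR.
Proof.
move=> B0 H; elim/big_ind: _ => //; first by rewrite absv0.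
by move=> x y; exact: absvD_le.
Qed.

Lemma absv_mul_le1 (x y : K) (B : R) :
  (absv x <= 1)%coqR -> (absv y <= B)%coqR -> (absv (x * y) <= B)%coqR.
Proof. by move=> h1 h2; rewrite absvM; have := absv_ge0 x; have := absv_ge0 y; nra. Qed.

(* An integer m prime to p satisfies u m - v p = 1, so m = 0 in K would force |p| >= 1. *)
Lemma Cp_char0 (n : nat) : n.+1%:R != 0 :> K.
Proof.
have [lo hi] := absv_p_bounds.
have p0 : p%:R != 0 :> K by apply/eqP => E; move: lo; rewrite E absv0; lra.
have pr : prime p by case: Cp => [[]].
have [m pm ->] := pfactor_coprime pr (ltn0Sn n).
rewrite natrM natrX mulf_eq0 negb_or expf_neq0 // andbT; apply/eqP => m0.
have m_gt0 : (0 < m)%N.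
  by case: m pm {m0} => //; rewrite /coprime gcdn0 => /eqP E; move: p_gt1; rewrite E.
move: pm; rewrite coprime_sym => /(coprimeP _ m_gt0) [[u v] /= E].
have : (v * p)%:R = -1 :> K.
  have : (u * m)%:R = (v * p + 1)%:R :> K by congr _%:R; lia.
  by rewrite natrM m0 mulr0 natrD => /esym/eqP; rewrite addr_eq0 => /eqP.
move/(congr1 absv); rewrite natrM absvM absvN absv1.
by have := absv_nat v; have := absv_ge0 v%:R; nra.
Qed.

Lemma absv_p_pow_cvg (eps : R) : (0 < eps)%coqR ->
  exists e, (absv (p%:R ^+ e) < eps)%coqR.
Proof.
move=> e0; have [lo hi] := absv_p_bounds.
have [|N HN] := pow_lt_1_zero (absv p%:R) _ eps e0; first by rewrite Rabs_pos_eq; lra.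
exists N; have := HN N (le_n _).
have -> : absv (p%:R ^+ N) = (absv p%:R ^ N)%coqR.
  by elim: (N) => [|k IH]; rewrite ?expr0 ?absv1 // exprS absvM IH.
by move/(Rle_lt_trans _ _ _ (Rle_abs _)).
Qed.

Lemma dvdn_fact_mono (m n : nat) : (m <= n)%N -> (m`! %| n`!)%N.
Proof. by move=> mn; rewrite -(bin_fact mn) dvdn_mull // dvdn_mulr. Qed.

(** Each further block of [p] factors ends with the multiple [p (e + 1)] of [p]. *)
Lemma dvdn_exp_fact (e : nat) : (p ^ e %| (p * e)`!)%N.
Proof.
elim: e => [|e IH]; first by rewrite muln0.
have -> : (p * e.+1 = (p * e + p.-1).+1)%N by have := p_gt1; lia.
rewrite factS expnS; apply: dvdn_mul.
  by have -> : ((p * e + p.-1).+1 = p * e.+1)%N; [have := p_gt1; lia | exact: dvdn_mulr].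
by apply: dvdn_trans IH _; apply: dvdn_fact_mono; exact: leq_addr.
Qed.

Lemma absv_fact_cvg0 (eps : R) : (0 < eps)%coqR ->
  exists N, forall k, (N <= k)%N -> (absv k`!%:R < eps)%coqR.
Proof.
move=> e0; have [e He] := absv_p_pow_cvg _ e0.
exists (p * e)%N => k Hk.
have /dvdnP[q ->] : (p ^ e %| k`!)%N.
  by apply: dvdn_trans (dvdn_exp_fact e) _; exact: dvdn_fact_mono.
rewrite natrM natrX; apply: Rle_lt_trans He.
by apply: absv_mul_le1; [exact: absv_nat | exact: Rle_refl].
Qed.

(** * The ring Z_p and continuous functions on it *)

(** Density of the naturals: adding [p^e |z|] to an approximating integer [z] makes it nonnegative
    and moves it by at most [|p^e|]. *)
Lemma in_Zp_nat_approx (x : K) (eps : R) : in_Zp absv x -> (0 < eps)%coqR ->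
  exists N : nat, (absv (x - N%:R) < eps)%coqR.
Proof.
move=> xZ e0; have [z Hz] := xZ _ e0; have [e He] := absv_p_pow_cvg _ e0.
have h : (0 <= z + (p ^ e * `|z|)%N :> int)%R.
  have : (0 < p ^ e)%N by rewrite expn_gt0 (ltnW p_gt1).
  by case: z {Hz} => z; nia.
exists `|(z + (p ^ e * `|z|)%N)%R|%N.
rewrite [X in x - X]pmulrn gez0_abs // rmorphD /= opprD addrA.
apply: absvB_lt => //; rewrite -pmulrn natrM natrX mulrC.
by apply: Rle_lt_trans He; apply: absv_mul_le1; [exact: absv_nat | exact: Rle_refl].
Qed.

Lemma in_Zp_int (z : int) : in_Zp absv z%:~R.
Proof. by move=> eps e0; exists z; rewrite subrr absv0. Qed.

Lemma in_ZpD (x y : K) : in_Zp absv x -> in_Zp absv y -> in_Zp absv (x + y).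
Proof.
move=> hx hy eps e0; have [z Hz] := hx _ e0; have [w Hw] := hy _ e0.
by exists (z + w); rewrite rmorphD /= opprD addrACA; exact: absvD_lt.
Qed.

Lemma in_Zp_nat (n : nat) : in_Zp absv n%:R.
Proof. exact: (in_Zp_int n). Qed.

Lemma in_ZpBnat (x : K) (n : nat) : in_Zp absv x -> in_Zp absv (x - n%:R).
Proof. by move=> hx; apply: in_ZpD => //; have := in_Zp_int (- n%:Z); rewrite rmorphN. Qed.

Lemma in_ZpN1 : in_Zp absv (-1).
Proof. exact: (in_Zp_int (-1)). Qed.

Lemma cont_Zp_const (c : K) : cont_Zp absv (fun=> c).
Proof. by move=> x _ eps e0; exists 1%coqR; split=> [|y _ _]; [lra | rewrite subrr absv0]. Qed.

Lemma cont_Zp_subnat (phi : K -> K) (n : nat) :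
  cont_Zp absv phi -> cont_Zp absv (fun x => phi (x - n%:R)).
Proof.
move=> H x xZ eps e0; have [d [d0 Hd]] := H _ (in_ZpBnat _ n xZ) eps e0.
exists d; split=> // y yZ xy; apply: Hd; first exact: in_ZpBnat.
by rewrite opprB addrA subrK.
Qed.

Lemma cont_Zp_succ (phi : K -> K) :
  cont_Zp absv phi -> cont_Zp absv (fun x => phi (x + 1)).
Proof.
move=> H x xZ eps e0; have [d [d0 Hd]] := H _ (in_ZpD _ _ xZ (in_Zp_nat 1)) eps e0.
exists d; split=> // y yZ xy; apply: Hd; first exact: (in_ZpD _ _ yZ (in_Zp_nat 1)).
by rewrite opprD addrACA subrr addr0.
Qed.

Lemma cont_ZpD (f g : K -> K) :
  cont_Zp absv f -> cont_Zp absv g -> cont_Zp absv (fun x => f x + g x).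
Proof.
move=> hf hg x xZ eps e0.
have [d1 [d10 H1]] := hf x xZ eps e0; have [d2 [d20 H2]] := hg x xZ eps e0.
exists (Rmin d1 d2); split=> [|y yZ xy]; first exact: Rmin_pos.
have m1 := Rmin_l d1 d2; have m2 := Rmin_r d1 d2.
by rewrite opprD addrACA; apply: absvD_lt; [apply: H1 | apply: H2] => //; lra.
Qed.

Lemma cont_ZpM (f g : K -> K) :
  cont_Zp absv f -> cont_Zp absv g -> cont_Zp absv (fun x => f x * g x).
Proof.
move=> hf hg x xZ eps e0.
have F0 := absv_ge0 (f x); have G0 := absv_ge0 (g x).
pose M := (1 + absv (f x) + absv (g x))%coqR.
have M0 : (0 < M)%coqR by rewrite /M; lra.
have [e [ee e1] eM] := small_factor M eps ltac:(lra) e0.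
have [d1 [d10 H1]] := hf x xZ e ee; have [d2 [d20 H2]] := hg x xZ e ee.
exists (Rmin d1 d2); split=> [|y yZ xy]; first exact: Rmin_pos.
have m1 := Rmin_l d1 d2; have m2 := Rmin_r d1 d2.
have h1 := H1 y yZ ltac:(lra); have h2 := H2 y yZ ltac:(lra).
have -> : f x * g x - f y * g y = (f x - f y) * g y + f x * (g x - g y) by ring.
have gy : (absv (g y) <= M)%coqR.
  rewrite (_ : g y = g x - (g x - g y)); last by ring.
  by apply: absvD_le; rewrite ?absvN /M; lra.
apply: absvD_lt; rewrite absvM; apply: Rle_lt_trans eM.
  by apply: Rmult_le_compat => //; try exact: absv_ge0; lra.
by rewrite Rmult_comm; apply: Rmult_le_compat; try exact: absv_ge0; rewrite /M; lra.
Qed.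

Lemma cont_Zp_sum (n : nat) (f : nat -> K -> K) :
  (forall i, cont_Zp absv (f i)) -> cont_Zp absv (fun x => \sum_(i < n) f i x).
Proof.
move=> H; elim: n => [|n IH] x xZ eps e0.
  by exists 1%coqR; split=> [|y _ _]; [lra | rewrite !big_ord0 subrr absv0].
have [d [d0 Hd]] := cont_ZpD _ _ IH (H n) x xZ eps e0.
by exists d; split=> // y yZ xy; rewrite !big_ord_recr; exact: Hd.
Qed.

Lemma cont_Zp_ffallK (n : nat) : cont_Zp absv (fun x => ffallK K x n).
Proof.
elim: n => [|n IH] x xZ eps e0.
  by exists 1%coqR; split=> [|y _ _]; [lra | rewrite /ffallK !big_ord0 subrr absv0].
have cid : cont_Zp absv id by move=> z zZ e e1; exists e.
have [d [d0 Hd]] := cont_ZpM _ _ IH (cont_Zp_subnat _ n cid) x xZ eps e0.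
by exists d; split=> // y yZ xy; rewrite !ffallKS; exact: Hd.
Qed.

(** If [|f x| > B], a natural [N] close to [x] gives [|f x - f N| < |f x|] and [|f N| < |f x|],
    against the ultrametric inequality. *)
Lemma cont_Zp_bound (f : K -> K) (B : R) (x : K) : cont_Zp absv f ->
  (forall N : nat, (absv (f N%:R) <= B)%coqR) -> in_Zp absv x -> (absv (f x) <= B)%coqR.
Proof.
move=> hf hB xZ; apply: Rnot_lt_le => H.
have B0 : (0 <= B)%coqR by apply: Rle_trans (hB 0%N); exact: absv_ge0.
have [d [d0 Hd]] := hf x xZ (absv (f x)) ltac:(lra).
have [N HN] := in_Zp_nat_approx x d xZ d0.
have h := Hd _ (in_Zp_nat N) HN.
suff : (absv (f x) < absv (f x))%coqR by lra.
rewrite -{1}(subrK (f N%:R) (f x)); apply: absvD_lt => //.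
exact: Rle_lt_trans (hB N) H.
Qed.

(** At naturals the value is an integer, and the bound passes to Z_p by continuity. *)
Lemma absv_binomK (x : K) (n : nat) : in_Zp absv x -> (absv (binomK x n) <= 1)%coqR.
Proof.
move=> xZ; have cf := cont_ZpM _ _ (cont_Zp_ffallK n) (cont_Zp_const (n`!%:R)^-1).
apply: (cont_Zp_bound _ _ x cf) => // N; rewrite -/(binomK _ n) binomK_nat.
  exact: absv_nat.
exact: Cp_char0.
Qed.

(** * Convergent series in C_p *)

Lemma cvg_seq_unique (u : nat -> K) (l m : K) : cvg_seq absv u l -> cvg_seq absv u m -> l = m.
Proof.
move=> hl hm; apply/eqP; rewrite -subr_eq0; apply/eqP/absv_eq0.
case: (Req_dec (absv (l - m)) 0) => // H.
have e0 : (0 < absv (l - m))%coqR by have := absv_ge0 (l - m); lra.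
have [N HN] := hl _ e0; have [M HM] := hm _ e0.
have h1 := HN (N + M)%N (leq_addr _ _); have h2 := HM (N + M)%N (leq_addl _ _).
suff : (absv (l - m) < absv (l - m))%coqR by lra.
rewrite {1}(_ : l - m = (u (N + M)%N - m) - (u (N + M)%N - l)); last by ring.
exact: absvB_lt.
Qed.

Lemma series_cvg_ssum (u : nat -> K) (l : K) : series_cvg absv u l -> ssum absv u = l.
Proof.
move=> H; apply: (cvg_seq_unique _ _ _ _ H).
exact: (ClassicalEpsilon.epsilon_spec (inhabits 0) _ (ex_intro _ l H)).
Qed.

Lemma series_cvg_unique (u v : nat -> K) (l m : K) : u =1 v ->
  series_cvg absv u l -> series_cvg absv v m -> l = m.
Proof.
move=> uv hu hv; apply: (cvg_seq_unique (fun m => \sum_(k < m) u k)) => // eps e0.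
have [N HN] := hv _ e0; exists N => i Ni.
by under eq_bigr do rewrite uv; exact: HN.
Qed.

Lemma series_cvgD (u v : nat -> K) (l m : K) :
  series_cvg absv u l -> series_cvg absv v m -> series_cvg absv (fun k => u k + v k) (l + m).
Proof.
move=> hu hv eps e0; have [N HN] := hu _ e0; have [M HM] := hv _ e0.
exists (N + M)%N => i Hi; rewrite big_split /= opprD addrACA.
by apply: absvD_lt; [apply: HN | apply: HM]; lia.
Qed.

Lemma series_cvgZ (c : K) (u : nat -> K) (l : K) :
  series_cvg absv u l -> series_cvg absv (fun k => c * u k) (c * l).
Proof.
move=> hu eps e0; have C0 := absv_ge0 c.
have [e [ee _] ec] := small_factor (absv c) eps C0 e0.
have [N HN] := hu _ ee; exists N => i Hi.
rewrite -mulr_sumr -mulrBr absvM Rmult_comm; apply: Rle_lt_trans ec.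
by apply: Rmult_le_compat_r => //; exact: Rlt_le (HN i Hi).
Qed.

Lemma series_cvg_sum (n : nat) (u : nat -> nat -> K) (l : nat -> K) :
  (forall j, series_cvg absv (u j) (l j)) ->
  series_cvg absv (fun k => \sum_(j < n) u j k) (\sum_(j < n) l j).
Proof.
move=> H; elim: n => [|n IH] eps e0.
  exists 0%N => i _; rewrite big_ord0 big1 ?subr0 ?absv0 // => k _.
  by rewrite big_ord0.
have [N HN] := series_cvgD _ _ _ _ IH (H n) eps e0; exists N => i Hi.
by rewrite big_ord_recr /=; under eq_bigr do rewrite big_ord_recr /=; exact: HN.
Qed.

Lemma series_cvg_behead (u : nat -> K) (l : K) :
  series_cvg absv u l -> series_cvg absv (fun k => u k.+1) (l - u 0%N).
Proof.
move=> hu eps e0; have [N HN] := hu _ e0; exists N => i Hi.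
have := HN i.+1 (leqW Hi); rewrite big_ord_recl /=.
by rewrite (_ : _ - (l - _) = u 0%N + \sum_(k < i) u k.+1 - l) //; ring.
Qed.

Lemma series_cvg_cons (u : nat -> K) (l : K) :
  series_cvg absv (fun k => u k.+1) l -> series_cvg absv u (u 0%N + l).
Proof.
move=> hu eps e0; have [N HN] := hu _ e0; exists N.+1 => -[|i] Hi //.
rewrite big_ord_recl /= opprD addrACA subrr add0r; exact: HN.
Qed.

Lemma series_cvg_finite (u : nat -> K) (n : nat) :
  (forall k, (n <= k)%N -> u k = 0) -> series_cvg absv u (\sum_(k < n) u k).
Proof.
move=> H eps e0; exists n => i ni.
rewrite -!(big_mkord xpredT u) (@big_cat_nat _ _ _ n) //= [X in _ + X - _]big_nat.
rewrite [X in _ + X - _]big1.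
  by rewrite addr0 subrr absv0.
by move=> k /andP[nk _]; exact: H.
Qed.

(** By the ultrametric inequality a block of terms is no larger than its largest term, so the
    partial sums are Cauchy. *)
Lemma series_cvg_null (u : nat -> K) : cvg_seq absv u 0 -> exists l, series_cvg absv u l.
Proof.
move=> hu; case: (Cp) => _ [compl _]; apply: compl => eps e0.
have [N HN] := hu _ e0; exists N.
suff W i j : (N <= i)%N -> (i <= j)%N ->
    (absv (\sum_(k < j) u k - \sum_(k < i) u k) < eps)%coqR.
  move=> i j Ni Nj; case: (leqP i j) => ij; last by apply: W => //; exact: ltnW.
  by rewrite absvB_sym; exact: W.
move=> Ni /subnKC <-; elim: (j - i)%N => [|d IH]; first by rewrite addn0 subrr absv0.
rewrite addnS big_ord_recr /= addrAC; apply: absvD_lt => //.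
by rewrite -[u _]subr0; apply: HN; lia.
Qed.

(** * The functional equation of phi_f *)

Variables (n : nat) (a : nat -> K) (phi : K -> K).
Hypothesis a_O : forall k, (k <= n)%N -> in_O absv (a k).
Hypothesis phi_cont : cont_Zp absv phi.
Hypothesis phi_A : A_eq absv phi (\poly_(k < n.+1) a k).

Lemma A_eq_phi (N : nat) : phi N%:R = N`!%:R * (expK absv (a 0%N) *
  (exp_trunc K (\poly_(k < n.+1) a k - (a 0%N)%:P) N)`_N).
Proof.
have := phi_A N; rewrite coef_poly /= => /(canRL (divfK (factF_neq0 _ Cp_char0 N))) ->.
rewrite mulrC; congr (_ * (_ * _)); rewrite /exp_trunc coef_sum.
by apply: eq_bigr => k _; rewrite coefZ mulrC.
Qed.

Lemma A_eq_phi0 : phi 0 = expK absv (a 0%N).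
Proof.
have := A_eq_phi 0; rewrite mulr0n => ->.
by rewrite /exp_trunc big_ord1 expr0 coefZ coef1 mul1r invr1 mulr1 mulr1.
Qed.

(** Coefficient of [t^N] in [A(phi)' = f' A(phi)], multiplied by [N!]; the quotient [N!/(N-j)!]
    becomes the falling factorial. *)
Lemma phi_succ_nat (N : nat) :
  phi (N%:R + 1) = \sum_(j < n) j.+1%:R * a j.+1 * (ffallK K N%:R j * phi (N%:R - j%:R)).
Proof.
set g := \poly_(k < n.+1) a k - (a 0%N)%:P.
have g0 : g`_0 = 0 by rewrite coefB coef_poly coefC subrr.
have gS j : g`_j.+1 = if (j < n)%N then a j.+1 else 0.
  by rewrite coefB coef_poly coefC subr0 ltnS.
rewrite natr1 A_eq_phi factS natrM -/g.
rewrite (_ : _ * _ = N`!%:R * expK absv (a 0%N) * (N.+1%:R * (exp_trunc K g N.+1)`_N.+1));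
  last by ring.
rewrite (coef_exp_trunc_rec _ Cp_char0) //.
(* The sum over [j < n] and the one over [j <= N] are both compared with a longer sum of [G], which
   vanishes for [j >= n] as [f'] has no such coefficient, and for [j > N] by the falling
   factorial. *)
pose G j := j.+1%:R * g`_j.+1 * (ffallK K N%:R j * phi (N%:R - j%:R)).
have -> : \sum_(j < n) j.+1%:R * a j.+1 * (ffallK K N%:R j * phi (N%:R - j%:R)) =
    \sum_(j < n + N.+1) G j.
  rewrite -(big_mkord xpredT G) (@big_cat_nat _ _ _ n) ?leq_addr //= big_mkord.
  rewrite [X in _ = _ + X]big_nat [X in _ = _ + X]big1 ?addr0.
    by apply: eq_bigr => j _; rewrite /G gS ltn_ord.
  by move=> j /andP[nj _]; rewrite /G gS ltnNge nj mulr0 mul0r.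
rewrite -(big_mkord xpredT G) (@big_cat_nat _ _ _ N.+1) ?leq_addl //= big_mkord.
rewrite [X in _ = _ + X]big_nat [X in _ = _ + X]big1 ?addr0; last first.
  move=> j /andP[Nj _]; rewrite /G -(fact_binomK _ Cp_char0).
  by rewrite (binomK_nat _ Cp_char0) ?bin_small ?mulr0 ?mul0r ?mulr0 //.
rewrite mulr_sumr; apply: eq_bigr => j _; rewrite /G.
have jN : (j <= N)%N by rewrite -ltnS.
rewrite -natrB // A_eq_phi -/g -(fact_binomK _ Cp_char0).
rewrite (binomK_nat _ Cp_char0).
by rewrite -(bin_fact jN) !natrM; ring.
Qed.

(** The difference [D] of the two sides is continuous and zero at the naturals, so [cont_Zp_bound]
    with bound zero applies. *)
Lemma phi_succ (x : K) : in_Zp absv x ->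
  phi (x + 1) = \sum_(j < n) j.+1%:R * a j.+1 * (ffallK K x j * phi (x - j%:R)).
Proof.
move=> xZ; apply/eqP; rewrite -subr_eq0 -mulN1r; apply/eqP/absv_eq0.
pose D x := phi (x + 1) + -1 * \sum_(j < n) j.+1%:R * a j.+1 * (ffallK K x j * phi (x - j%:R)).
apply: Rle_antisym; last exact: absv_ge0.
apply: (cont_Zp_bound D 0 x) => // [|N]; last first.
  by rewrite /D phi_succ_nat mulN1r subrr absv0; exact: Rle_refl.
apply: cont_ZpD; first exact: cont_Zp_succ.
apply: cont_ZpM; first exact: cont_Zp_const.
apply: (cont_Zp_sum n (fun j x => j.+1%:R * a j.+1 * (ffallK K x j * phi (x - j%:R)))) => j.
apply: cont_ZpM; first exact: cont_Zp_const.
by apply: cont_ZpM; [exact: cont_Zp_ffallK | exact: cont_Zp_subnat].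
Qed.

(** Strong induction at naturals: the functional equation has coefficients of absolute value at most
    one, and its terms with [j > N] vanish, so only values at smaller naturals occur. *)
Lemma phi_bounded (x : K) : in_Zp absv x -> (absv (phi x) <= absv (phi 0))%coqR.
Proof.
apply: cont_Zp_bound => //; elim/ltn_ind => -[|N] IH; first exact: Rle_refl.
rewrite -natr1 phi_succ_nat; apply: absv_sum_le => [|j _]; first exact: absv_ge0.
have [jN|Nj] := leqP j N; last first.
  rewrite -(fact_binomK _ Cp_char0).
  rewrite (binomK_nat _ Cp_char0).
  by rewrite bin_small // !(mulr0, mul0r) absv0; exact: absv_ge0.
rewrite -natrB //; apply: absv_mul_le1.
  by apply: absv_mul_le1; [exact: absv_nat | apply: a_O; exact: ltn_ord].
apply: absv_mul_le1; last by apply: IH; rewrite ltnS leq_subr.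
rewrite -(fact_binomK _ Cp_char0).
by apply: absv_mul_le1; [exact: absv_nat | apply: absv_binomK; exact: in_Zp_nat].
Qed.

(** * The operators S^s and the p-adic recurrence *)

(* [Sterm 0 s x] are the terms of S^s(phi)(x); the higher [Sterm j] are, up to
   an index shift, those of the iterated differences of s |-> S^s(phi)(x). *)
Definition Sterm (j : nat) (s x : K) (k : nat) : K :=
  (-1) ^+ k * (j + k)`!%:R * binomK s k * binomK x (j + k) * phi (x - (j + k)%:R).

Lemma Sterm_ffallK (j : nat) (s x : K) (k : nat) :
  Sterm j s x k = (-1) ^+ k * binomK s k * (ffallK K x (k + j) * phi (x - (k + j)%:R)).
Proof. by rewrite /Sterm [(k + j)%N]addnC -(fact_binomK _ Cp_char0); ring. Qed.

(** The factor [(j+k)!] tends to zero p-adically while all the others stay bounded. *)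
Lemma Sterm_null (j : nat) (s x : K) : in_Zp absv s -> in_Zp absv x ->
  cvg_seq absv (Sterm j s x) 0.
Proof.
move=> sZ xZ eps e0.
have [e [ee _] eB] := small_factor (absv (phi 0)) eps (absv_ge0 _) e0.
have [N HN] := absv_fact_cvg0 e ee; exists N => k Nk; rewrite subr0 /Sterm.
apply: Rle_lt_trans eB; rewrite absvM; apply: Rmult_le_compat; try exact: absv_ge0.
  rewrite mulrC; apply: absv_mul_le1; first exact: absv_binomK.
  rewrite mulrC; apply: absv_mul_le1; first exact: absv_binomK.
  apply: absv_mul_le1; first by rewrite absv_sign; exact: Rle_refl.
  by apply: Rlt_le; apply: HN; exact: leq_trans (leq_addl _ _).
by apply: phi_bounded; exact: in_ZpBnat.
Qed.

Lemma Sop_cvg (s x : K) : in_Zp absv s -> in_Zp absv x ->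
  series_cvg absv (Sterm 0 s x) (Sop absv s phi x).
Proof.
move=> sZ xZ; have [l Hl] := series_cvg_null _ (Sterm_null 0 _ _ sZ xZ).
by rewrite /Sop (series_cvg_ssum _ _ Hl).
Qed.

(** Pascal's rule in [s] leaves minus the binomial of index [k]; the sign is absorbed by
    [(-1)^(k+1)], and the lost unit of [k] moves into [j]. *)
Lemma Sterm_diff (j : nat) (s x : K) (k : nat) :
  Sterm j s x k.+1 - Sterm j (s + 1) x k.+1 = Sterm j.+1 s x k.
Proof.
rewrite /Sterm (binomKS _ Cp_char0).
by rewrite addnS addSn exprS; ring.
Qed.

Lemma Sterm_cvg (j : nat) (s x : K) : in_Zp absv s -> in_Zp absv x ->
  series_cvg absv (Sterm j s x)
    (\sum_(m < j.+1) (-1) ^+ m * 'C(j, m)%:R * Sop absv (s + m%:R) phi x).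
Proof.
move=> sZ xZ; elim: j s sZ => [|j IH] s sZ.
  by rewrite big_ord1 mul1r mul1r addr0; exact: Sop_cvg.
rewrite (sum_binom_diff K (fun m => Sop absv (s + m%:R) phi x)).
have H1 := IH s sZ; have H2 := IH (s + 1) (in_ZpD _ _ sZ (in_Zp_nat 1)).
(* The terms of index zero agree, since they contain [binomK s 0 = 1]; removing them shifts the
   index and leaves the sum unchanged. *)
have E0 : Sterm j s x 0 + -1 * Sterm j (s + 1) x 0 = 0.
  by rewrite mulN1r /Sterm !binomK0 subrr.
have := series_cvg_behead _ _ (series_cvgD _ _ _ _ H1 (series_cvgZ (-1) _ _ H2)).
rewrite E0 subr0 mulN1r.
have -> : \sum_(m < j.+1) (-1) ^+ m * 'C(j, m)%:R * Sop absv (s + 1 + m%:R) phi x =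
          \sum_(m < j.+1) (-1) ^+ m * 'C(j, m)%:R * Sop absv (s + m.+1%:R) phi x.
  by apply: eq_bigr => m _; rewrite -addrA nat1r.
move=> H eps e0; have [N HN] := H eps e0; exists N => i Ni.
have := HN i Ni; under eq_bigr do rewrite mulN1r Sterm_diff.
by [].
Qed.

Lemma sum_cK_Sop_cvg (s x : K) : in_Zp absv s -> in_Zp absv x ->
  series_cvg absv (fun k => \sum_(j < n) j.+1%:R * a j.+1 * Sterm j s x k)
    (\sum_(m < n) (-1) ^+ m * cK n a m * Sop absv (s + m%:R) phi x).
Proof.
move=> sZ xZ; rewrite (sum_cK K n a (fun m => Sop absv (s + m%:R) phi x)).
apply: (series_cvg_sum n (fun j k => j.+1%:R * a j.+1 * Sterm j s x k)
  (fun j => j.+1%:R * a j.+1 *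
     \sum_(m < j.+1) (-1) ^+ m * 'C(j, m)%:R * Sop absv (s + m%:R) phi x)).
by move=> j; apply: series_cvgZ; exact: Sterm_cvg.
Qed.

(** At [s = 0] the factor [binomK 0 k] kills every term with [k > 0]; the term [k = 0] is the
    functional equation at [x]. *)
Lemma phi_succ_Sop (x : K) : in_Zp absv x ->
  phi (x + 1) = \sum_(m < n) (-1) ^+ m * cK n a m * Sop absv m%:R phi x.
Proof.
move=> xZ; have H := sum_cK_Sop_cvg 0 x (in_Zp_nat 0) xZ.
under eq_bigr do rewrite -[X in Sop _ X]add0r.
have Sterm0 j k : (0 < k)%N -> Sterm j 0 x k = 0.
  case: k => // k _; have E : binomK 0 k.+1 = 0 :> K by exact: (binomK_nat _ Cp_char0 0 k.+1).
  by rewrite /Sterm E mulr0 !mul0r.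
pose t k := \sum_(j < n) j.+1%:R * a j.+1 * Sterm j 0 x k.
have t0 k : (1 <= k)%N -> t k = 0.
  by move=> k0; rewrite /t big1 // => j _; rewrite Sterm0 ?mulr0.
rewrite (series_cvg_unique t t _ _ (frefl _) H (series_cvg_finite _ 1 t0)).
rewrite big_ord1 /= phi_succ //; apply: eq_bigr => j _.
rewrite /Sterm /= addn0 expr0 binomK0 mul1r mulr1 -(fact_binomK _ Cp_char0) //.
Qed.

Lemma Top_recurrence (s : K) : in_Zp absv s ->
  expK absv (a 0%N) + s * Top absv phi (s - 1) =
  \sum_(m < n) (-1) ^+ m * cK n a m * Top absv phi (s + m%:R).
Proof.
move=> sZ; have H := sum_cK_Sop_cvg s (-1) sZ in_ZpN1.
(* The series of [w] is summed twice. Its head is [phi 0] and its tail is [s] times the series of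
   [S^(s-1)(phi)(-1)]; expanding [phi] by the functional equation at [-1 - k] gives the series in
   [H]. *)
pose w k := ffallK K s k * phi (-1 - k%:R + 1).
have S1 : series_cvg absv w (w 0%N + s * Top absv phi (s - 1)).
  apply: series_cvg_cons.
  have Z := series_cvgZ s _ _ (Sop_cvg (s - 1) (-1) (in_ZpBnat _ 1 sZ) in_ZpN1).
  move=> eps e0; have [N HN] := Z _ e0; exists N => i Ni; have := HN i Ni.
  congr (Rlt (absv (_ - _)) _); apply: eq_bigr => k _.
  rewrite /w Sterm_ffallK addn0 ffallKN1 ffallKS_l -(fact_binomK _ Cp_char0).
  (* The signs from [(-1)^k] and from the falling factorial of [-1] cancel; the square of [(-1)^k]
     is inserted so that [ring] can match them. *)
  rewrite -natr1 opprD addrA addrNK -[RHS]mul1r -[X in _ = X * _](sqrr_sign K k); ring.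
have -> : expK absv (a 0%N) = w 0%N.
  by rewrite /w -A_eq_phi0 /ffallK big_ord0 mul1r subr0 addNr.
apply: (series_cvg_unique _ _ _ _ _ S1 H) => k.
rewrite /w phi_succ; last exact: (in_ZpBnat _ k in_ZpN1).
rewrite mulr_sumr; apply: eq_bigr => j _.
rewrite Sterm_ffallK ffallKD ffallKN1 natrD opprD addrA -(fact_binomK _ Cp_char0 s).
by rewrite -[LHS]mul1r -[X in X * _ = _](sqrr_sign K k); ring.
Qed.
End PadicAnalysis.

Theorem theorem8p4 :
  (* complex case *)
  (forall (n : nat) (a : nat -> C),
      (1 <= n)%N -> a n <> RtoC R0 ->
      Rlt (Rmult (pow (Ropp R1) n) (Re (a n))) R0 ->
      (forall s : C, exists l : C,
          @is_RInt_gen C_R_NormedModule (PhiC_integrand n a s)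
            (Rbar_locally m_infty) (at_point R0) l)
      /\ (forall x : R, Rle x R0 ->
          @is_derive R_AbsRing C_R_NormedModule (phiC n a) x
            (sum_n (fun m => Cmult (Cmult (RtoC (pow (Ropp R1) m)) (cC n a m))
                                   (Cmult (RtoC (pow (Rminus R1 x) m)) (phiC n a x)))
                   n.-1))
      /\ (forall s : C,
          Cplus (cexp (a 0%N)) (Cmult s (PhiC n a (Cminus s (RtoC R1)))) =
          sum_n (fun m => Cmult (Cmult (RtoC (pow (Ropp R1) m)) (cC n a m))
                                (PhiC n a (Cplus s (RtoC (INR m)))))
                n.-1))
  /\
  (* p-adic case, over any model (K, absv) of C_p *)
  (forall (K : closedFieldType) (absv : K -> R) (p n : nat) (a : nat -> K)
          (phi : K -> K),
      is_Cp absv p ->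
      (1 <= n)%N -> a n != 0 ->
      (forall k, (k <= n)%N -> in_O absv (a k)) ->
      in_Ep absv p (a 0%N) -> in_U1 absv (a 1%N) ->
      cont_Zp absv phi ->
      A_eq absv phi (\poly_(k < n.+1) a k) ->
      (forall x : K, in_Zp absv x ->
          phi (x + 1) = \sum_(m < n) (-1) ^+ m * cK n a m * Sop absv m%:R phi x)
      /\ (forall s : K, in_Zp absv s ->
          expK absv (a 0%N) + s * Top absv phi (s - 1) =
          \sum_(m < n) (-1) ^+ m * cK n a m * Top absv phi (s + m%:R))).
Proof.
split.
- move=> n a n1 _ an; split; first by move=> s; exact: PhiC_cvg.
  split; first by move=> x _; exact: phiC_derive.
  by move=> s; exact: PhiC_recurrence.
- move=> K absv p n a phi Cp _ _ aO _ _ phi_cont phi_A; split.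
  + by move=> x xZ; exact: (phi_succ_Sop _ _ _ Cp _ _ _ aO phi_cont phi_A).
  + by move=> s sZ; exact: (Top_recurrence _ _ _ Cp _ _ _ aO phi_cont phi_A).
Qed.
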